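(* Let $F$ be an $\mathcal{L}_1$-space, let $E$ be a Banach space which contains $\ell^\infty_n$ uniformly ($n=1,2,\dots$), and let $Q:F\to E$ be a surjective bounded linear operator. Then there exists a bounded linear operator from $\ker Q$ into a Hilbert space which is not 2-absolutely summing.
   Context: An $\mathcal{L}_1$-space is a Banach space $F$ for which there is $\sigma\in[1,\infty)$ such that every finite dimensional subspace of $F$ is contained in a finite dimensional subspace $F_\alpha$ of $F$ whose Banach–Mazur distance to $\ell^1_{\dim F_\alpha}$ is at most $\sigma$. $\ell^\infty_n$ is the $n$-dimensional scalar space with the maximum norm. $E$ contains $\ell^\infty_n$ uniformly if there is $C<\infty$ such that for each $n\ge 1$ there is a subspace $E_n\subset E$ with Banach–Mazur distance $d(E_n,\ell^\infty_n)\le C$. A bounded linear operator $u:X\to H$ is 2-absolutely summing if there is $K<\infty$ such that $\sum_i\|u(x_i)\|^2\le K^2\sup\{\sum_i|x^*(x_i)|^2: x^*\in X^*,\ \|x^*\|\le 1\}$ for all finite sequences $(x_i)$ in $X$. *)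

(* Defs.v *)
From HB Require Import structures.
From mathcomp Require Import all_boot all_order all_algebra.
From mathcomp Require Import all_classical all_reals all_analysis.
From mathcomp Require Import complex.

Set Implicit Arguments.
Unset Strict Implicit.
Unset Printing Implicit Defensive.

Import Order.TTheory GRing.Theory Num.Theory.
Import numFieldNormedType.Exports.

Local Open Scope classical_set_scope.
Local Open Scope ring_scope.

(* Norms of a [normedModType K] take their values in [K] itself; when [K] is
   [R[i]] these are the nonnegative reals of [R[i]], whose order only compares
   numbers with the same imaginary part.  Suprema and infima of sets of such
   numbers, taken in [K], are therefore the usual real ones. *)
Definition real_or_complex (R : realType) (K : numFieldType) : Prop :=
  K = (R : numFieldType) \/ K = (R[i] : numFieldType).

(* The conjugation of the scalar field, uniformly in the real and complex
   cases; see [scalar_conj_real] and [scalar_conj_complex]. *)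
Definition scalar_conj (K : numFieldType) (a : K) : K := `|a| ^+ 2 / a.

Lemma scalar_conj_real (R : realType) (a : R) : scalar_conj a = a.
Proof.
rewrite /scalar_conj real_normK ?num_real//.
by have [->|a0] := eqVneq a 0; [rewrite expr0n mul0r|rewrite expr2 mulfK].
Qed.

Lemma scalar_conj_complex (R : realType) (a : R[i]) :
  scalar_conj a = conjc a.
Proof.
rewrite /scalar_conj normCK.
have [->|a0] := eqVneq a 0; first by rewrite !mul0r (rmorph0 (@conjc R)).
by rewrite mulrAC divff// mul1r.
Qed.

Record lsubspace (K : numFieldType) (V : lmodType K) := LSubspace {
  lsubspace_pred :> {pred V};
  lsubspace_closed : submod_closed lsubspace_pred }.

Section LSubspaceType.
Variables (K : numFieldType) (V : normedModType K) (S : lsubspace V).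

HB.instance Definition _ :=
  GRing.isSubmodClosed.Build K V (lsubspace_pred S) (lsubspace_closed S).

Inductive lsubspace_of : predArgType := LSubspaceOf u & u \in lsubspace_pred S.

Definition lsubspace_val w : V := let: LSubspaceOf u _ := w in u.

HB.instance Definition _ := [isSub of lsubspace_of for lsubspace_val].
HB.instance Definition _ := [Choice of lsubspace_of by <:].
HB.instance Definition _ := [SubChoice_isSubZmodule of lsubspace_of by <:].
HB.instance Definition _ := [SubZmodule_isSubLmodule of lsubspace_of by <:].

Definition lsubspace_norm (w : lsubspace_of) : K := `|val w|.

Let lsubspace_ler_normD x y :
  lsubspace_norm (x + y) <= lsubspace_norm x + lsubspace_norm y.
Proof. exact: ler_normD. Qed.

Let lsubspace_normrZ (a : K) x :
  lsubspace_norm (a *: x) = `|a| * lsubspace_norm x.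
Proof. exact: normrZ. Qed.

Let lsubspace_normr0_eq0 x : lsubspace_norm x = 0 -> x = 0.
Proof. by move=> /normr0_eq0 x0; exact: val_inj. Qed.

HB.instance Definition _ := Lmodule_isNormed.Build K lsubspace_of
  lsubspace_ler_normD lsubspace_normrZ lsubspace_normr0_eq0.

End LSubspaceType.

Section Kernel.
Variables (K : numFieldType) (V W : normedModType K) (f : {linear V -> W}).

Let ker_closed : submod_closed [pred x | f x == 0].
Proof.
split=> [|a x y]; first by rewrite inE linear0.
by rewrite !inE linearP => /eqP-> /eqP->; rewrite scaler0 addr0.
Qed.

Definition lin_ker : lsubspace V := LSubspace ker_closed.

End Kernel.

Section Dimension.
Variables (K : numFieldType) (V : lmodType K).

Definition has_dim (S : lsubspace V) (n : nat) : Prop :=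
  exists e : 'I_n -> V,
    (forall x, x \in S <->
       exists a : 'I_n -> K, x = \sum_(i < n) a i *: e i) /\
    (forall a : 'I_n -> K,
       \sum_(i < n) a i *: e i = 0 -> forall i, a i = 0).

Definition finite_dim (S : lsubspace V) : Prop := exists n, has_dim S n.

End Dimension.

(* The library norm on matrices is the maximum norm of the entries, so [l1]
   is an alias that carries the other norm. *)

Definition linf (K : numFieldType) (n : nat) : normedModType K := 'rV[K]_n.

Definition l1 (K : numFieldType) (n : nat) : Type := 'rV[K]_n.

Section L1.
Variables (K : numFieldType) (n : nat).

HB.instance Definition _ := GRing.Lmodule.copy (l1 K n) 'rV[K]_n.

Definition l1_norm (x : l1 K n) : K := \sum_(i < n) `|(x : 'rV[K]_n) 0 i|.

Let l1_ler_normD x y : l1_norm (x + y) <= l1_norm x + l1_norm y.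
Proof.
by rewrite /l1_norm -big_split; apply: ler_sum => i _; rewrite mxE ler_normD.
Qed.

Let l1_normrZ (a : K) x : l1_norm (a *: x) = `|a| * l1_norm x.
Proof.
by rewrite /l1_norm mulr_sumr; apply: eq_bigr => i _; rewrite mxE normrM.
Qed.

Let l1_normr0_eq0 x : l1_norm x = 0 -> x = 0.
Proof.
move=> x0; apply/rowP => i; rewrite mxE; apply: normr0_eq0.
exact: (psumr_eq0P _ x0).
Qed.

HB.instance Definition _ := Lmodule_isNormed.Build K (l1 K n)
  l1_ler_normD l1_normrZ l1_normr0_eq0.

End L1.

Section Operators.
Variables (K : numFieldType) (X Y : normedModType K).

Definition bounded_op (f : {linear X -> Y}) : Prop :=
  bounded_near f (nbhs (0 : X)).

(* The supremum exists when [f] is bounded; otherwise this is a dummy value. *)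
Definition opnorm (f : {linear X -> Y}) : K :=
  supremum 0 [set `|f x| | x in [set x : X | `|x| <= 1]].

End Operators.

Section BanachMazur.
Variables (K : numFieldType) (X Y : normedModType K).

Definition bm_set : set K :=
  [set c | exists (f : {linear X -> Y}) (g : {linear Y -> X}),
     [/\ bounded_op f, bounded_op g, cancel f g, cancel g f &
         c = opnorm f * opnorm g]].

(* When [X] and [Y] are not isomorphic, [bm_dist] is a dummy value standing for
   infinity, which [bm_dist_le] rules out. *)
Definition bm_dist : K := infimum 0 bm_set.

Definition bm_dist_le (c : K) : Prop := bm_set !=set0 /\ bm_dist <= c.

End BanachMazur.

Definition script_L1_space (K : numFieldType) (F : completeNormedModType K)
    : Prop :=
  exists2 sigma : K, 1 <= sigma &
    forall G : lsubspace F, finite_dim G ->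
      exists (Fa : lsubspace F) (n : nat),
        [/\ {subset G <= Fa}, has_dim Fa n &
            bm_dist_le (lsubspace_of Fa) (l1 K n) sigma].

Definition contains_linf_uniformly (K : numFieldType)
    (E : completeNormedModType K) : Prop :=
  exists C : K, forall n : nat, (1 <= n)%N ->
    exists En : lsubspace E, bm_dist_le (lsubspace_of En) (linf K n) C.

Definition is_hilbert (K : numFieldType) (H : completeNormedModType K) : Prop :=
  exists phi : {dot H for @scalar_conj K}, forall x : H, phi x x = `|x| ^+ 2.

Definition two_summing (K : numFieldType) (X H : normedModType K)
    (u : {linear X -> H}) : Prop :=
  exists2 C : K, 0 <= C &
    forall (n : nat) (x : 'I_n -> X),
      \sum_(i < n) `|u (x i)| ^+ 2 <=
      C ^+ 2 * supremum 0 [set \sum_(i < n) `|f (x i)| ^+ 2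
                          | f in [set f : {linear X -> K^o} |
                                  bounded_op f /\ opnorm f <= 1]].

(* Main.v *)
Require Import Defs.
From HB Require Import structures.
From mathcomp Require Import all_boot all_order all_algebra.
From mathcomp Require Import all_classical all_reals all_analysis.
From mathcomp Require Import complex.
From mathcomp Require Import ring lra.

Set Implicit Arguments.
Unset Strict Implicit.
Unset Printing Implicit Defensive.

Import Order.TTheory GRing.Theory Num.Theory.
Import numFieldNormedType.Exports.

Local Open Scope classical_set_scope.
Local Open Scope ring_scope.

(** The Kalton-Peck map [Om y i = y i * ln (|y i| / |y|)] of [K^k] is additive up
    to a bounded error although it is far from linear: it vanishes on the unit
    vectors and is multiplication by [- ln (sqrt k)] on the vectors with
    coordinates [+-1 / sqrt k].  Let [pi : E -> K^k] give the Rademacher coefficients of the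
    coordinates on a copy of [linf] over the sign cube, extended to [E] by
    Hahn-Banach.  As [F] is an [L1]-space, [Om \o pi \o Q] is within a bounded
    distance of a linear map [w : F -> K^k], which is therefore bounded on
    [ker Q] uniformly in [k].

    A Riesz product provides functions [f_e] on the cube, bounded uniformly in
    [k], with [pi f_e = e / sqrt k] and [avg_e (e_i f_e) = r_i / sqrt k] for the
    Rademacher functions [r_i].  If [H_e] and [R_i] are bounded lifts of [f_e]
    and [r_i] to [F], the vectors [z_i = avg_e (e_i H_e) - R_i / sqrt k] of
    [ker Q] have a bounded weak 2-summing norm, while [sum_i |w z_i|^2] is at
    least of order [(ln k)^2].  A weighted [l2]-sum of such maps [w] over
    suitable [k] is the required operator. *)

(** * Scalars *)

(** For a linear map [T] on [E], the identity [avg_e (e_i f_e) = r_i / sqrt k] forces [avg_e sum_i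
    e_i (T f_e)_i = sum_i (T r_i)_i / sqrt k]. With [Om \o pi] for [T], the left side is
    [- sqrt k * ln (sqrt k)] and the right side is [0]. Since [w] is linear and follows
    [Om \o pi \o Q] up to a bounded error, this discrepancy has to appear on the kernel vectors, as
    the trace [sum_i (w z_i)_i]. The obvious flat functions [sum_l e_l r_l / sqrt k] reach the value
    [sqrt k] on the cube, so they have no uniformly bounded lifts. A Riesz product has the same
    Rademacher coefficients; its other Walsh terms are invisible to [pi] and vanish in the average
    over [e]. The geometry of [F] matters because the error of [Om] on [sum_j a_j y_j] is controlled
    by [sum_j |a_j| |y_j|], a quantity that only an [l1] basis bounds by the norm of the
    combination. *)

(* A uniform view of the real and the complex scalars: every scalar is
   [re z + unit * im z], where [unit] is [0] over [R] and ['i] over [R[i]]. *)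
Record scalar_parts (R : realType) (K : numFieldType) := ScalarParts {
  ofR : {rmorphism R -> K};
  re : K -> R;
  im : K -> R;
  iunit : K;
  ler_ofR : forall a b, (ofR a <= ofR b) = (a <= b);
  ge0_ofR : forall z, 0 <= z -> z = ofR (re z);
  ofRK : cancel ofR re;
  reD : {morph re : x y / x + y};
  imD : {morph im : x y / x + y};
  re_ofRM : forall a z, re (ofR a * z) = a * re z;
  re_iunitM : forall z, re (iunit * z) = - im z;
  scalarE : forall z, z = ofR (re z) + iunit * ofR (im z);
  ler_norm_re : forall z, ofR `|re z| <= `|z|;
  ler_norm_im : forall z, ofR `|im z| <= `|z|;
  iunit_sqr : iunit = 0 \/ iunit * iunit = -1;
  ler_norm_iunit : `|iunit| <= 1;
  scalar_conjD : {morph @scalar_conj K : x y / x + y} }.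

Lemma real_scalar_parts (R : realType) : scalar_parts R (R : numFieldType).
Proof.
apply: (@ScalarParts R R (idfun : {rmorphism R -> R}) idfun (fun=> 0) 0) => //=.
- by move=> x y; rewrite addr0.
- by move=> z; rewrite mul0r oppr0.
- by move=> z; rewrite mulr0 addr0.
- by move=> z; rewrite normr0.
- by left.
- by rewrite normr0.
- by move=> x y; rewrite !scalar_conj_real.
Qed.

Lemma complex_scalar_parts (R : realType) :
  scalar_parts R (R[i] : numFieldType).
Proof.
apply: (@ScalarParts R (R[i] : numFieldType)
  (@real_complex R : {rmorphism R -> R[i]}) (@complex.Re R) (@complex.Im R) 'i%C).
- by move=> a b; rewrite lecR.
- by move=> z z0; exact/esym/RRe_real/ger0_real.
- by [].
- by case=> ? ? [].
- by case=> ? ? [].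
- by move=> a [x y] /=; rewrite mul0r subr0.
- by move=> z; rewrite mulrC ReiNIm.
- exact: complexE.
- exact: normc_ge_Re.
- move=> z; have := normc_ge_Re (z * 'i%C).
  rewrite ReiNIm normrN normrM; congr (_ <= _).
  by rewrite [X in _ * X]normc_def /= expr0n/= add0r expr1n sqrtr1 mulr1.
- by right; rewrite -expr2 sqr_i.
- by rewrite normc_def /= expr0n/= add0r expr1n sqrtr1.
- by move=> x y; rewrite !scalar_conj_complex rmorphD.
Qed.

Lemma real_or_complex_parts (R : realType) (K : numFieldType) :
  real_or_complex R K -> inhabited (scalar_parts R K).
Proof.
by case=> ->; constructor; [exact: real_scalar_parts|exact: complex_scalar_parts].
Qed.

Section RealNorm.
Variables (R : realType) (K : numFieldType) (S : scalar_parts R K).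
Local Notation ofR := (ofR S).

(** The norm as an element of the ordered field [R], where suprema and linear arithmetic are
    available. *)
Definition nm (V : normedZmodType K) (x : V) : R := re S `|x|.

Lemma ofR_nm (V : normedZmodType K) (x : V) : ofR (nm x) = `|x|.
Proof. by rewrite -ge0_ofR. Qed.

Lemma ofR_ge0 a : (0 <= ofR a) = (0 <= a).
Proof. by rewrite -(rmorph0 ofR) ler_ofR. Qed.

Lemma ofR_inj : injective ofR.
Proof. exact: can_inj (ofRK S). Qed.

Lemma ltr_ofR a b : (ofR a < ofR b) = (a < b).
Proof. by rewrite !lt_neqAle ler_ofR (inj_eq ofR_inj). Qed.

Lemma nm_le (V : normedZmodType K) (x : V) c : (`|x| <= ofR c) = (nm x <= c).
Proof. by rewrite -ofR_nm ler_ofR. Qed.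

Lemma nm_ge0 (V : normedZmodType K) (x : V) : 0 <= nm x.
Proof. by rewrite -ofR_ge0 ofR_nm. Qed.

Lemma nmN (V : normedZmodType K) (x : V) : nm (- x) = nm x.
Proof. by rewrite /nm normrN. Qed.

Lemma nmD (V : normedZmodType K) (x y : V) : nm (x + y) <= nm x + nm y.
Proof. by rewrite -nm_le rmorphD /= !ofR_nm ler_normD. Qed.

Lemma nmB (V : normedZmodType K) (x y : V) : nm (x - y) <= nm x + nm y.
Proof. by rewrite -(nmN y) nmD. Qed.

Lemma nmBC (V : normedZmodType K) (x y : V) : nm (x - y) = nm (y - x).
Proof. by rewrite -nmN opprB. Qed.

Lemma nm0 (V : normedZmodType K) : nm (0 : V) = 0.
Proof. by apply: ofR_inj; rewrite ofR_nm normr0 rmorph0. Qed.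

Lemma nm_eq0 (V : normedZmodType K) (x : V) : (nm x == 0) = (x == 0).
Proof. by rewrite -(inj_eq ofR_inj) ofR_nm rmorph0 normr_eq0. Qed.

Lemma nm_sum (V : normedZmodType K) I (r : seq I) (P : pred I) (f : I -> V) :
  nm (\sum_(i <- r | P i) f i) <= \sum_(i <- r | P i) nm (f i).
Proof.
rewrite -nm_le rmorph_sum; apply: le_trans (ler_norm_sum _ _ _) _.
by apply: ler_sum => i _; rewrite ofR_nm.
Qed.

Lemma nmM (a b : K) : nm (a * b) = nm a * nm b.
Proof. by apply: ofR_inj; rewrite rmorphM /= !ofR_nm normrM. Qed.

Lemma nmZ (V : normedModType K) (a : K) (x : V) : nm (a *: x) = nm a * nm x.
Proof. by apply: ofR_inj; rewrite rmorphM /= !ofR_nm normrZ. Qed.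

Lemma nm_ofR a : nm (ofR a) = `|a|.
Proof.
apply: ofR_inj; rewrite ofR_nm; case: (ger0P a) => a0.
  by rewrite ger0_norm// ofR_ge0.
by rewrite ler0_norm ?rmorphN// -oppr_ge0 -rmorphN ofR_ge0 oppr_ge0 ltW.
Qed.

Lemma nm1 : nm (1 : K) = 1.
Proof. by rewrite -(rmorph1 ofR) nm_ofR normr1. Qed.

Lemma norm_re_le (z : K) : `|re S z| <= nm z.
Proof. by rewrite -(ler_ofR S) ofR_nm ler_norm_re. Qed.

Lemma norm_im_le (z : K) : `|im S z| <= nm z.
Proof. by rewrite -(ler_ofR S) ofR_nm ler_norm_im. Qed.

Lemma nm_lt_gt0 (e : K) : 0 < e -> e = ofR (re S e) /\ 0 < re S e.
Proof.
move=> e0; have eE := ge0_ofR S (ltW e0); split=> //.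
by rewrite -ltr_ofR -eE rmorph0.
Qed.

Lemma mul_scalar_conj (z : K) : z * scalar_conj z = ofR (nm z ^+ 2).
Proof.
rewrite /scalar_conj rmorphXn /= ofR_nm.
have [->|z0] := eqVneq z 0; first by rewrite mul0r normr0 expr0n.
by rewrite mulrCA divff// mulr1.
Qed.

Lemma nm_scalar_conj (z : K) : nm (scalar_conj z) = nm z.
Proof.
have [->|z0] := eqVneq z 0; first by rewrite /scalar_conj invr0 mulr0.
have nz0 : nm z != 0 by rewrite nm_eq0.
by apply: (mulfI nz0); rewrite -nmM mul_scalar_conj nm_ofR ger0_norm ?sqr_ge0.
Qed.

Lemma re0 : re S 0 = 0.
Proof. by rewrite -(rmorph0 ofR) ofRK. Qed.

(** Decomposing [ofR a] by [scalarE] leaves [iunit * ofR (im (ofR a)) = 0]. Either [iunit = 0], and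
    [re_iunitM] kills [im], or the second factor is [0]. *)
Lemma im_ofR a : im S (ofR a) = 0.
Proof.
apply/eqP; rewrite -oppr_eq0 -re_iunitM; apply/eqP.
have := scalarE S (ofR a); rewrite ofRK -[LHS]addr0 => /addrI/esym/eqP.
rewrite mulf_eq0 => /orP[/eqP->|]; first by rewrite mul0r re0.
by rewrite -(rmorph0 ofR) (inj_eq ofR_inj) re_iunitM => /eqP->; rewrite oppr0.
Qed.

Lemma scalar_conjM (a b : K) :
  scalar_conj (a * b) = scalar_conj a * scalar_conj b.
Proof. by rewrite /scalar_conj normrM exprMn invfM mulrACA. Qed.

Lemma scalar_conj_ofR a : scalar_conj (ofR a) = ofR a.
Proof.
have [->|a0] := eqVneq a 0; first by rewrite rmorph0 /scalar_conj invr0 mulr0.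
have oa0 : ofR a != 0 by rewrite -(rmorph0 ofR) (inj_eq ofR_inj).
apply: (mulfI oa0); rewrite mul_scalar_conj nm_ofR -rmorphM real_normK//.
exact: num_real.
Qed.

Lemma scalar_conjK : involutive (@scalar_conj K).
Proof.
move=> a; have [->|a0] := eqVneq a 0; first by rewrite /scalar_conj !(invr0, mulr0).
have ca0 : scalar_conj a != 0 by rewrite -(nm_eq0) nm_scalar_conj nm_eq0.
by apply: (mulfI ca0); rewrite mul_scalar_conj nm_scalar_conj -mul_scalar_conj mulrC.
Qed.

Lemma scalar_conjB (a b : K) :
  scalar_conj (a - b) = scalar_conj a - scalar_conj b.
Proof.
have h : scalar_conj (-1 : K) = -1 by rewrite -(rmorphN1 ofR) scalar_conj_ofR.
by rewrite (scalar_conjD S) -mulN1r scalar_conjM h mulN1r.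
Qed.

(** * Finite families in the Euclidean norm *)

Section L2Norm.
Variable I : finType.
Implicit Types x y : I -> K.

Lemma sum_mul_sqr_le (a b : I -> R) :
  (\sum_i a i * b i) ^+ 2 <= (\sum_i a i ^+ 2) * (\sum_i b i ^+ 2).
Proof.
set A := \sum_i a i ^+ 2; set B := \sum_i b i ^+ 2; set C := \sum_i _.
have B0 : 0 <= B by apply: sumr_ge0 => i _; exact: sqr_ge0.
have [Bz|Bn0] := eqVneq B 0.
  suff -> : C = 0 by rewrite expr0n Bz mulr0.
  apply: big1 => i _.
  have /eqP : b i ^+ 2 = 0 by apply: (psumr_eq0P _ Bz) => // j _; exact: sqr_ge0.
  by rewrite sqrf_eq0 => /eqP ->; rewrite mulr0.
have Bp : 0 < B by rewrite lt_neqAle eq_sym Bn0.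
have : 0 <= \sum_i (B * a i - C * b i) ^+ 2.
  by apply: sumr_ge0 => i _; exact: sqr_ge0.
have -> : \sum_i (B * a i - C * b i) ^+ 2 = B * (A * B - C ^+ 2).
  transitivity (B ^+ 2 * A - 2 * B * C * C + C ^+ 2 * B); last by ring.
  transitivity (\sum_i (B ^+ 2 * a i ^+ 2 - 2 * B * C * (a i * b i) +
      C ^+ 2 * b i ^+ 2)); first by apply: eq_bigr => i _; ring.
  by rewrite big_split sumrB -!mulr_sumr.
by rewrite pmulr_rge0// subr_ge0.
Qed.

Definition l2 x : R := Num.sqrt (\sum_i nm (x i) ^+ 2).

Lemma l2_ge0 x : 0 <= l2 x.
Proof. exact: sqrtr_ge0. Qed.

Lemma sqr_l2 x : l2 x ^+ 2 = \sum_i nm (x i) ^+ 2.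
Proof. by rewrite sqr_sqrtr// sumr_ge0// => i _; exact: sqr_ge0. Qed.

Lemma nm_le_l2 x i : nm (x i) <= l2 x.
Proof.
rewrite -(@ler_pXn2r _ 2)// ?nnegrE ?nm_ge0 ?l2_ge0// sqr_l2 (bigD1 i)//=.
by rewrite lerDl sumr_ge0// => j _; exact: sqr_ge0.
Qed.

Lemma eq_l2 x y : x =1 y -> l2 x = l2 y.
Proof. by move=> xy; rewrite /l2; under eq_bigr do rewrite xy. Qed.

Lemma l2_0 : l2 (fun=> 0) = 0.
Proof. by rewrite /l2 big1 ?sqrtr0// => i _; rewrite nm0 expr0n. Qed.

Lemma l2_eq0 x : l2 x = 0 -> forall i, x i = 0.
Proof.
move=> x0 i; apply/eqP; rewrite -nm_eq0 eq_le nm_ge0 andbT.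
by rewrite -x0 nm_le_l2.
Qed.

Lemma sum_nmM_le x y : \sum_i nm (x i) * nm (y i) <= l2 x * l2 y.
Proof.
rewrite -(@ler_pXn2r _ 2)// ?nnegrE ?mulr_ge0 ?l2_ge0//.
  by rewrite exprMn !sqr_l2 sum_mul_sqr_le.
by rewrite sumr_ge0// => i _; rewrite mulr_ge0 ?nm_ge0.
Qed.

Lemma nm_sumM_le x y : nm (\sum_i x i * y i) <= l2 x * l2 y.
Proof.
apply: le_trans (nm_sum _ _ _) _; under eq_bigr do rewrite nmM.
exact: sum_nmM_le.
Qed.

Lemma l2D x y : l2 (fun i => x i + y i) <= l2 x + l2 y.
Proof.
rewrite -(@ler_pXn2r _ 2)// ?nnegrE ?addr_ge0 ?l2_ge0//.
rewrite sqrrD !sqr_l2.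
apply: (@le_trans _ _ (\sum_i (nm (x i) + nm (y i)) ^+ 2)).
  apply: ler_sum => i _; rewrite ler_pXn2r ?nnegrE ?addr_ge0 ?nm_ge0//.
  exact: nmD.
under eq_bigr do rewrite sqrrD.
rewrite 2!big_split /= lerD2r lerD2l sumrMnl lerMn2r.
exact: sum_nmM_le.
Qed.

Lemma l2Z (a : K) x : l2 (fun i => a * x i) = nm a * l2 x.
Proof.
apply/eqP; rewrite -(@eqrXn2 _ 2)// ?mulr_ge0 ?l2_ge0 ?nm_ge0//.
rewrite exprMn !sqr_l2 mulr_sumr; apply/eqP/eq_bigr => i _.
by rewrite nmM exprMn.
Qed.

(** Testing on the conjugate of [x] turns the hypothesis into [l2 x ^+ 2 <= M * l2 x]. *)
Lemma l2_dual x M : 0 <= M ->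
  (forall v : I -> K, nm (\sum_i x i * v i) <= M * l2 v) -> l2 x <= M.
Proof.
move=> M0 /(_ (fun i => scalar_conj (x i))).
under eq_bigr do rewrite mul_scalar_conj.
rewrite -rmorph_sum -sqr_l2 nm_ofR ger0_norm ?sqr_ge0//.
rewrite /l2; under [in X in _ <= _ * X]eq_bigr do rewrite nm_scalar_conj.
rewrite -/(l2 x); have [->//|x0] := eqVneq (l2 x) 0.
by rewrite expr2 ler_pM2r// lt_neqAle eq_sym x0 l2_ge0.
Qed.

End L2Norm.

End RealNorm.

(** * The open mapping theorem *)

Section Completeness.
Variables (R : realType) (K : numFieldType) (S : scalar_parts R K).
Local Notation nm := (nm S).
Local Notation ofR := (ofR S).

Lemma expr_half_gt0 n : 0 < (2^-1 : R) ^+ n.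
Proof. by rewrite exprn_gt0// invr_gt0. Qed.

Lemma exists_expr_half_lt (C e : R) : 0 < e -> exists n, C * 2^-1 ^+ n < e.
Proof.
move=> e0; have e1 : 0 < e / (1 + `|C|).
  by rewrite divr_gt0// ltr_pwDl.
have [n _ nP] := near_infty_natSinv_expn_lt (PosNum e1).
exists n; have := nP n (leqnn n); rewrite /= div1r -exprVn.
rewrite ltr_pdivlMr ?ltr_pwDl// mulrC; apply: le_lt_trans.
rewrite ler_pM2r ?expr_half_gt0//.
by apply: le_trans (ler_norm C) _; rewrite lerDr.
Qed.

(** [b] is both a Cauchy modulus and the error bound for the limit, so the centres of nested balls
    converge to a point of all of them. *)
Lemma complete_cvg (V : completeNormedModType K) (u : nat -> V) (b : nat -> R) :
  (forall n m, (n <= m)%N -> nm (u m - u n) <= b n) ->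
  (forall e, 0 < e -> exists n, b n < e) ->
  exists l, forall n, nm (l - u n) <= b n.
Proof.
move=> ub b0.
have cu : cauchy (u @ \oo).
  apply: cauchy_exP => e e0; have [eE re0] := nm_lt_gt0 S e0.
  have [n bn] := b0 _ re0; exists (u n); exists n => // m /= nm_.
  rewrite -ball_normE /ball_ /= eE -(ofR_nm S) ltr_ofR nmBC.
  exact: le_lt_trans (ub _ _ nm_) bn.
have /cauchy_cvgP/cvg_ex[l ul] := cu.
exists l => n; apply/ler_addgt0Pr => e e0.
have e0' : 0 < ofR e by rewrite -(rmorph0 ofR) ltr_ofR.
have /cvgrPdist_le/(_ _ e0')[N _ NP] := ul.
have := NP (maxn N n) (leq_maxl _ _); rewrite nm_le => le1.
rewrite -(subrK (u (maxn N n)) l) -addrA addrC.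
by apply: le_trans (nmD _ _ _) _; rewrite lerD// ub ?leq_maxr.
Qed.

End Completeness.

Section OpenMapping.
Variables (R : realType) (K : numFieldType) (S : scalar_parts R K).
Local Notation nm := (nm S).
Local Notation ofR := (ofR S).
Variables (F E : completeNormedModType K) (Q : {linear F -> E}) (M : R).
Hypothesis QM : forall x, nm (Q x) <= M * nm x.
Hypothesis Qsurj : forall y, exists x, Q x = y.

(* Baire's argument for the images of the balls of integral radius *)
Let ball_image_dense : exists (n : nat) (y0 : E) (r : R), 0 < r /\
  forall y, nm (y - y0) <= r -> forall d, 0 < d ->
    exists2 x, nm x <= n%:R & nm (y - Q x) <= d.
Proof.
apply: contrapT => nex.
(* If density fails everywhere, every ball [p] contains a ball [q] of at most half its radius that
   misses the image of the ball of radius [n]. The value [(0, 0)] for a nonpositive radius only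
   makes [choice] applicable. *)
have step (n : nat) (p : E * R) : exists q : E * R, 0 < p.2 ->
    [/\ 0 < q.2, q.2 <= p.2 / 2, nm (q.1 - p.1) + q.2 <= p.2 &
      forall x, nm x <= n%:R -> ~ nm (Q x - q.1) <= q.2].
  case: p => y0 r /=; have [r0|] := ltP 0 r; last by exists (0, 0).
  apply: contrapT => nq; apply: nex; exists n, y0, (r / 2); split.
    by rewrite divr_gt0.
  move=> y yr d d0; apply: contrapT => nx; apply: nq.
  exists (y, Num.min d (r / 2)) => _ /=; split.
  - by rewrite lt_min d0 divr_gt0.
  - by rewrite ge_min lexx orbT.
  - rewrite [leRHS](splitr r) lerD//.
    by rewrite ge_min lexx orbT.
  - move=> x xn; rewrite le_min nmBC => /andP[xd _]; apply: nx.
    by exists x.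
have {step} [f fP] := choice (fun np : nat * (E * R) => step np.1 np.2).
pose s := fix s n := if n is m.+1 then f (m, s m) else (0 : E, 1 : R).
have s0 n : 0 < (s n).2.
  by elim: n => [|n IH] //=; case: (fP (n, s n) IH).
have sn n : [/\ (s n.+1).2 <= (s n).2 / 2,
    nm ((s n.+1).1 - (s n).1) + (s n.+1).2 <= (s n).2 &
    forall x, nm x <= n%:R -> ~ nm (Q x - (s n.+1).1) <= (s n.+1).2].
  by case: (fP (n, s n) (s0 n)).
have nest n m : (n <= m)%N -> nm ((s m).1 - (s n).1) + (s m).2 <= (s n).2.
  move=> /subnK <-; elim: (m - n)%N => [|k IH].
    by rewrite add0n subrr nm0 add0r.
  rewrite addSn; have [_ h _] := sn (k + n)%N.
  have := nmD S ((s (k + n).+1).1 - (s (k + n)%N).1) ((s (k + n)%N).1 - (s n).1).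
  rewrite addrA subrK; lra.
have half n : (s n).2 <= 1 * 2^-1 ^+ n.
  elim: n => [|n IH]; first by rewrite expr0 mulr1.
  have [h _ _] := sn n; rewrite exprS; lra.
have [l lP] : exists l, forall n, nm (l - (s n).1) <= (s n).2.
  apply: (@complete_cvg R K S E (fun n => (s n).1) (fun n => (s n).2)) => [n m nm_|e e0].
    by have := nest _ _ nm_; have := s0 m; lra.
  have [n ne] := exists_expr_half_lt 1 e0.
  by exists n; apply: le_lt_trans ne.
have [x xl] := Qsurj l.
have [n nx] : exists n : nat, nm x <= n%:R.
  by exists (Num.trunc (nm x)).+1; apply/ltW/truncnS_gt.
have [_ _ /(_ x nx)] := sn n; apply; rewrite xl; exact: lP.
Qed.

(** Subtracting approximate preimages of [ofR t *: y + y0] and of [y0], with [t = r / nm y],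
    recentres the ball at the origin. The two errors [r / 4] add up to [r / 2], which is [nm y / 2]
    after division by [t]. *)
Let almost_lift : exists2 c, 0 <= c & forall y, exists2 x, nm x <= c * nm y &
  nm (y - Q x) <= nm y / 2.
Proof.
have [n [y0 [r [r0 rP]]]] := ball_image_dense.
exists (2 * n%:R / r); first by rewrite divr_ge0 ?mulr_ge0// ltW.
move=> y; have [->|yn0] := eqVneq y 0.
  exists 0; first by rewrite !nm0 mulr0.
  by rewrite linear0 subr0 nm0 mul0r.
have y0' : 0 < nm y by rewrite lt_neqAle nm_ge0 andbT eq_sym nm_eq0.
pose t := r / nm y.
have t0 : 0 < t by rewrite divr_gt0.
have r4 : 0 < r / 4 by rewrite divr_gt0.
have ty : nm (ofR t *: y) = r by rewrite nmZ nm_ofR gtr0_norm// /t divfK// gt_eqF.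
have [|x1 x1n x1P] := rP (ofR t *: y + y0) _ _ r4.
  by rewrite addrK ty.
have [|x2 x2n x2P] := rP y0 _ _ r4; first by rewrite subrr nm0 ltW.
exists (ofR t^-1 *: (x1 - x2)).
  rewrite nmZ nm_ofR gtr0_norm ?invr_gt0//.
  have -> : 2 * n%:R / r * nm y = t^-1 * (2 * n%:R).
    by rewrite /t invf_div; ring.
  rewrite ler_pM2l ?invr_gt0//; have := nmB S x1 x2; lra.
have -> : y - Q (ofR t^-1 *: (x1 - x2)) =
    ofR t^-1 *: (ofR t *: y - Q (x1 - x2)).
  rewrite linearZ scalerBr scalerA -rmorphM mulVf ?gt_eqF// rmorph1 scale1r//.
rewrite nmZ nm_ofR gtr0_norm ?invr_gt0//.
have -> : nm y / 2 = t^-1 * (r / 2).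
  by rewrite /t invf_div; field; rewrite gt_eqF.
rewrite ler_pM2l ?invr_gt0//.
have -> : ofR t *: y - Q (x1 - x2) = (ofR t *: y + y0 - Q x1) - (y0 - Q x2).
  rewrite linearB opprB; move: (ofR t *: y) (Q x1) (Q x2) => a c d.
  by rewrite opprB (addrC a y0) -!addrA (addrC y0) !addrA subrK addrAC.
have := nmB S (ofR t *: y + y0 - Q x1) (y0 - Q x2); lra.
Qed.

Lemma open_mapping : exists2 c, 0 <= c &
  forall y, exists2 x, Q x = y & nm x <= c * nm y.
Proof.
have [c c0 cP] := almost_lift.
have lift y : exists x, nm x <= c * nm y /\ nm (y - Q x) <= nm y / 2.
  by have [x ? ?] := cP y; exists x.
have [X XP] := choice lift.
exists (2 * c); first by rewrite mulr_ge0.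
move=> y.
(* [w n] is the residual left by the first [n] approximate lifts, and [s n] is the sum of these
   lifts. *)
pose w := fix w n := if n is m.+1 then w m - Q (X (w m)) else y.
pose s n := \sum_(k < n) X (w k).
have wle n : nm (w n) <= nm y * 2^-1 ^+ n.
  elim: n => [|n IH]; first by rewrite expr0 mulr1.
  have [_ h] := XP (w n); rewrite exprS /=; lra.
have ws n : w n = y - Q (s n).
  elim: n => [|n IH]; first by rewrite /s big_ord0 linear0 subr0.
  by rewrite /s big_ord_recr /= linearD opprD addrA {1}IH.
(* The subtracted term [2^-1 ^+ m] lets the induction close: it pays for the next lift. *)
have sle n m : (n <= m)%N ->
    nm (s m - s n) <= 2 * c * nm y * (2^-1 ^+ n - 2^-1 ^+ m).
  move=> /subnK <-; elim: (m - n)%N => [|k IH].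
    by rewrite add0n !subrr nm0 mulr0.
  rewrite addSn /s big_ord_recr /= -/(s _) -/(s _).
  have [h _] := XP (w (k + n)%N).
  have h2 : c * nm (w (k + n)%N) <= c * (nm y * 2^-1 ^+ (k + n)%N).
    by rewrite ler_wpM2l.
  rewrite addrAC; apply: le_trans (nmD _ _ _) _.
  rewrite exprS; move: IH h h2.
  set p := 2^-1 ^+ _; set q := 2^-1 ^+ _; set a := nm _; set b := nm (X _).
  by move=> IH h h2; nra.
have cy0 : 0 <= 2 * c * nm y by rewrite !mulr_ge0 ?nm_ge0.
have [l lP] : exists l, forall n, nm (l - s n) <= 2 * c * nm y * 2^-1 ^+ n.
  apply: complete_cvg => [n m nm_|e e0].
    apply: le_trans (sle _ _ nm_) _; rewrite ler_wpM2l//.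
    by rewrite gerBl ltW ?expr_half_gt0.
  exact: exists_expr_half_lt.
exists l; last first.
  by have := lP 0%N; rewrite /s big_ord0 subr0 expr0 mulr1.
apply/eqP; rewrite -subr_eq0 -(nm_eq0 S) eq_le nm_ge0 andbT.
apply/ler_addgt0Pr => e e0; rewrite add0r.
pose C := nm y + `|M| * (2 * c * nm y).
have [n ne] := exists_expr_half_lt C e0.
apply: le_trans (ltW ne).
have -> : Q l - y = Q (l - s n) - w n.
  by rewrite ws linearB opprB addrA subrK.
apply: le_trans (nmB _ _ _) _; rewrite /C mulrDl addrC lerD//.
apply: le_trans (QM _) _.
apply: (@le_trans _ _ (`|M| * nm (l - s n))).
  by rewrite ler_wpM2r ?nm_ge0// ler_norm.
by rewrite -[leRHS]mulrA ler_wpM2l.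
Qed.

End OpenMapping.

(** * The Hahn-Banach theorem *)

Section HahnBanach.
Variables (R : realType) (V : lmodType R).
Implicit Types p q : V -> R.

(** Homogeneity is asked as an inequality, which passes easily to infima; applying it to [t^-1]
    gives the equality. *)
Definition sublinear p := (forall x y, p (x + y) <= p x + p y) /\
  (forall t x, 0 < t -> p (t *: x) <= t * p x).

Lemma sublinearZ p t x : sublinear p -> 0 < t -> p (t *: x) = t * p x.
Proof.
move=> [_ pZ] t0; apply/eqP; rewrite eq_le pZ//=.
rewrite -ler_pdivlMl//; have := pZ t^-1 (t *: x).
by rewrite invr_gt0 scalerA mulVf ?gt_eqF// scale1r; apply.
Qed.

Lemma sublinear0 p : sublinear p -> p 0 = 0.
Proof.
by move=> /(@sublinearZ p 2 0)/(_ (ltr0n _ _)); rewrite scaler0; lra.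
Qed.

Lemma sublinear_ge p x : sublinear p -> - p (- x) <= p x.
Proof.
move=> sp; have := sp.1 x (- x); rewrite subrr sublinear0//; lra.
Qed.

(** Zorn's lemma for the reversed pointwise order. The bound of a nonempty chain is its pointwise
    infimum, finite because [- p0 (- x)] lies below; totality of the chain makes it subadditive. *)
Lemma minimal_sublinear p0 : sublinear p0 ->
  exists p, [/\ sublinear p, forall x, p x <= p0 x &
    forall q, sublinear q -> (forall x, q x <= p x) -> q = p].
Proof.
move=> sp0.
pose T := {p : V -> R | sublinear p /\ forall x, p x <= p0 x}.
pose r (s t : T) : bool := `[< forall x, sval t x <= sval s x >].
have [||||p pmin] := @Zorn T r.
- by move=> t; apply/asboolP.
- move=> s t u /asboolP st /asboolP tu; apply/asboolP => x.
  exact: le_trans (tu x) (st x).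
- move=> [s sP] [t tP] /asboolP /= st /asboolP /= ts.
  by apply: eq_exist; apply/funext => x; apply/eqP; rewrite eq_le st ts.
- move=> A Atot; have [[a Aa]|A0] := pselect (A !=set0); last first.
    exists (exist _ p0 (conj sp0 (fun x => lexx _))) => s As.
    by exfalso; apply: A0; exists s.
  pose B x := [set sval s x | s in A].
  have B0 x : B x !=set0 by exists (sval a x), a.
  have Blb x : has_lbound (B x).
    exists (- p0 (- x)) => _ [s As <-].
    have [ss sp] := svalP s; apply: le_trans (sublinear_ge x ss).
    by rewrite lerN2.
  have infle s x : A s -> inf (B x) <= sval s x.
    by move=> As; apply: ge_inf => //; exists s.
  pose m x := inf (B x).
  have sm : sublinear m.
    split=> [x y|t x t0].
      rewrite -lerBlDr; apply: lb_le_inf => // _ [s As <-].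
      rewrite lerBlDl -lerBlDr; apply: lb_le_inf => // _ [t At <-].
      rewrite lerBlDr; have [/asboolP st|/asboolP ts] := Atot _ _ As At.
        apply: le_trans (infle t _ At) _; have [[tD _] _] := svalP t.
        by apply: le_trans (tD _ _) _; rewrite [leRHS]addrC lerD2r.
      apply: le_trans (infle s _ As) _; have [[sD _] _] := svalP s.
      by apply: le_trans (sD _ _) _; rewrite [leRHS]addrC lerD2l.
    rewrite -ler_pdivrMl//; apply: lb_le_inf => // _ [s As <-].
    rewrite ler_pdivrMl//; apply: le_trans (infle s _ As) _.
    by have [[_ sZ] _] := svalP s; exact: sZ.
  have mp0 x : m x <= p0 x.
    by apply: le_trans (infle a _ Aa) _; have [_] := svalP a; exact.
  by exists (exist _ m (conj sm mp0)) => s As; apply/asboolP => x; exact: infle.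
have [sp pp0] := svalP p.
exists (sval p); split=> // q sq qp.
have qp0 x : q x <= p0 x by apply: le_trans (qp x) (pp0 x).
have pq : r p (exist _ q (conj sq qp0)) by exact/asboolP.
by have /(congr1 (fun t : T => sval t)) := pmin _ pq.
Qed.

(** For fixed [v], the infimum [q y] of [p (y + t *: v) - t * p v] over [t >= 0] is sublinear and
    below [p], hence equal to [p]. Taking [t = 1] gives [p x + p v <= p (x + v)]. *)
Lemma minimal_sublinearD p : sublinear p ->
  (forall q, sublinear q -> (forall x, q x <= p x) -> q = p) ->
  {morph p : x y / x + y}.
Proof.
move=> sp pmin x v; apply/eqP; rewrite eq_le sp.1 /=.
pose B y := [set p (y + t *: v) - t * p v | t in [set t | 0 <= t]].
have B0 y : B y !=set0 by exists (p (y + 0 *: v) - 0 * p v), 0 => /=.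
have pvE t : 0 <= t -> p (t *: v) = t * p v.
  rewrite le_eqVlt => /orP[/eqP<-|t0]; last exact: sublinearZ.
  by rewrite scale0r mul0r sublinear0.
have Blb y : lbound (B y) (- p (- y)).
  move=> _ [t /= t0 <-]; have := sp.1 (y + t *: v) (- y).
  rewrite addrAC subrr add0r pvE//; lra.
have Bh y : has_lbound (B y) by exists (- p (- y)).
pose q y := inf (B y).
have qle y t : 0 <= t -> q y <= p (y + t *: v) - t * p v.
  by move=> t0; apply: ge_inf => //; exists t.
have sq : sublinear q.
  split=> [y z|t y t0].
    rewrite -lerBlDr; apply: lb_le_inf => // _ [s /= s0 <-].
    rewrite lerBlDl -lerBlDr; apply: lb_le_inf => // _ [t /= t0 <-].
    rewrite lerBlDr; apply: le_trans (qle _ (t + s) _) _; first exact: addr_ge0.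
    rewrite scalerDl [y + z]addrC addrACA.
    have := sp.1 (z + t *: v) (y + s *: v); lra.
  rewrite -ler_pdivrMl//; apply: lb_le_inf => // _ [s /= s0 <-].
  rewrite ler_pdivrMl//; apply: le_trans (qle _ (t * s) _) _.
    by rewrite mulr_ge0 ?(ltW t0).
  by rewrite -scalerA -scalerDr (sublinearZ _ sp t0) mulrBr mulrA.
have /pmin <- // : forall y, q y <= p y.
  by move=> y; have := qle y 0 (lexx _); rewrite scale0r addr0 mul0r subr0.
have := qle x 1 ler01; rewrite scale1r mul1r.
have -> : q = p.
  apply: pmin => // y.
  by have := qle y 0 (lexx _); rewrite scale0r addr0 mul0r subr0.
lra.
Qed.

Theorem hahn_banach p : sublinear p -> exists f : V -> R,
  [/\ {morph f : x y / x + y}, forall t x, f (t *: x) = t * f x &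
    forall x, f x <= p x].
Proof.
move=> /minimal_sublinear[f [sf fp fmin]]; exists f.
have fD := minimal_sublinearD sf fmin; split=> // t x.
have fN y : f (- y) = - f y.
  by apply/eqP; rewrite -addr_eq0 -fD addNr sublinear0.
have [t0|t0|<-] := ltgtP 0 t; first exact: sublinearZ.
  rewrite -[t]opprK scaleNr fN sublinearZ ?oppr_gt0//.
  by rewrite !mulNr.
by rewrite scale0r mul0r sublinear0.
Qed.

End HahnBanach.

Definition pack_linear (K : numFieldType) (V W : lmodType K) (f : V -> W)
    (lf : linear f) : {linear V -> W} :=
  HB.pack f (GRing.isLinear.Build _ _ _ _ _ lf).

(** An alias that carries the real vector space structure of a [K]-space, so that the real
    Hahn-Banach theorem applies to it. *)
Definition restrict_scalars (R : realType) (K : numFieldType)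
  (S : scalar_parts R K) (V : lmodType K) : Type := V.

Section RestrictScalars.
Variables (R : realType) (K : numFieldType) (S : scalar_parts R K).
Variable V : lmodType K.

HB.instance Definition _ := GRing.Zmodule.copy (restrict_scalars S V) V.

Let scale (a : R) (x : restrict_scalars S V) : restrict_scalars S V :=
  ofR S a *: (x : V).

Let scaleA a b x : scale a (scale b x) = scale (a * b) x.
Proof. by rewrite /scale scalerA rmorphM. Qed.

Let scale1 : left_id 1 scale.
Proof. by move=> x; rewrite /scale rmorph1 scale1r. Qed.

Let scaleDr : right_distributive scale +%R.
Proof. by move=> a x y; rewrite /scale scalerDr. Qed.

Let scaleDl x : {morph scale^~ x : a b / a + b}.
Proof. by move=> a b; rewrite /scale rmorphD scalerDl. Qed.

HB.instance Definition _ := GRing.Zmodule_isLmodule.Build R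
  (restrict_scalars S V) scaleA scale1 scaleDr scaleDl.

Lemma restrict_scalarsE (a : R) (x : restrict_scalars S V) :
  a *: x = (ofR S a *: (x : V) : V).
Proof. by []. Qed.

End RestrictScalars.

Section LsubspaceVal.
Variables (K : numFieldType) (V : normedModType K) (W : lsubspace V).

Lemma lsubspace_val_linear :
  linear (@lsubspace_val K V W).
Proof. by []. Qed.

HB.instance Definition _ := GRing.isLinear.Build K (lsubspace_of W) V _
  (@lsubspace_val K V W) lsubspace_val_linear.

Lemma nm_lsubspace (R : realType) (S : scalar_parts R K) (w : lsubspace_of W) :
  nm S w = nm S (lsubspace_val w).
Proof. by []. Qed.

End LsubspaceVal.

(** * Extension of functionals over either scalar field *)

Section Extension.
Variables (R : realType) (K : numFieldType) (S : scalar_parts R K).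
Local Notation nm := (nm S).
Local Notation ofR := (ofR S).

(** Applied to values of a linear functional, this recovers the functional from its real part. *)
Lemma reM_ofRl (z : K) : z = ofR (re S z) - iunit S * ofR (re S (iunit S * z)).
Proof. by rewrite re_iunitM rmorphN mulrN opprK -scalarE. Qed.

(* a real functional [f] is the real part of [x |-> f x - i f (i x)] *)
Let complexify (V : lmodType K) (f : V -> R) (x : V) : K :=
  ofR (f x) - iunit S * ofR (f (iunit S *: x)).

Let complexify_linear (V : lmodType K) (f : V -> R) :
  {morph f : x y / x + y} -> (forall t x, f (ofR t *: x) = t * f x) ->
  linear (complexify f : V -> K^o).
Proof.
move=> fD fZ.
have f0 : f 0 = 0.
  have := fZ 0 0; by rewrite mul0r scaler0.
have fN x : f (- x) = - f x.
  by apply/eqP; rewrite -addr_eq0 -fD addNr f0.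
have cD x y : complexify f (x + y) = complexify f x + complexify f y.
  rewrite /complexify scalerDr !fD !rmorphD mulrDr opprD addrACA//.
have cR t x : complexify f (ofR t *: x) = ofR t * complexify f x.
  rewrite /complexify scalerA [iunit S * ofR t]mulrC -scalerA !fZ !rmorphM mulrBr.
  by congr (_ - _); rewrite mulrCA.
have cI x : complexify f (iunit S *: x) = iunit S * complexify f x.
  rewrite /complexify scalerA; case: (iunit_sqr S) => h.
    by rewrite h !(mul0r, scale0r) f0 rmorph0 subrr.
  rewrite h scaleN1r fN rmorphN mulrBr mulrA h mulN1r mulrN !opprK addrC//.
move=> a x y; rewrite cD; congr (_ + _).
rewrite {1}(scalarE S a) scalerDl cD [iunit S * ofR (im S a)]mulrC -scalerA !cR cI.
by rewrite mulrA -mulrDl [_ * iunit S]mulrC -scalarE.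
Qed.

(** [hahn_banach] prescribes no values, so these are built into the sublinear function [p x], the
    infimum over [w] of [nm (x - w) + re (phi w)]. It is at most [nm x], and at most [re (phi w)] at
    [w]; using [w] and [- w] gives equality there. *)
Lemma hahn_banach_extension (V : normedModType K) (W : lsubspace V)
    (phi : {linear lsubspace_of W -> K^o}) :
  (forall x, nm (phi x) <= nm (lsubspace_val x)) ->
  exists f : {linear V -> K^o},
    (forall x, f (lsubspace_val x) = phi x) /\ (forall x, nm (f x) <= nm x).
Proof.
move=> phi1.
pose V' := restrict_scalars S V.
pose B (x : V') := [set nm ((x : V) - lsubspace_val w) + re S (phi w) |
  w in [set: lsubspace_of W]].
have B0 x : B x !=set0 by exists (nm ((x : V) - lsubspace_val (0 : lsubspace_of W)) + re S (phi 0)), 0.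
have reN z : re S (- z) = - re S z.
  have re0 : re S 0 = 0 by rewrite -(rmorph0 ofR) ofRK.
  by apply/eqP; rewrite -addr_eq0 -reD addNr re0.
have Blb x : lbound (B x) (- nm (x : V)).
  move=> _ [w _ <-].
  have h1 : nm (lsubspace_val w) <= nm ((x : V) - lsubspace_val w) + nm (x : V).
    by rewrite nmBC; apply: le_trans (nmD _ _ _); rewrite subrK.
  have h2 : - nm (lsubspace_val w) <= re S (phi w).
    rewrite lerNl; apply: le_trans (phi1 _); apply: le_trans (norm_re_le _ _).
    by rewrite -normrN ler_norm.
  lra.
have Bh x : has_lbound (B x) by exists (- nm (x : V)).
pose p (x : V') := inf (B x).
have ple x w : p x <= nm ((x : V) - lsubspace_val w) + re S (phi w).
  by apply: ge_inf => //; exists w.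
have sp : sublinear p.
  split=> [x y|t x t0].
    rewrite -lerBlDr; apply: lb_le_inf => // _ [w _ <-].
    rewrite lerBlDl -lerBlDr; apply: lb_le_inf => // _ [v _ <-].
    rewrite lerBlDr; apply: le_trans (ple _ (v + w)) _.
    rewrite (linearD phi) reD (linearD (@lsubspace_val K V W)) opprD
      [X in nm (X + _)]addrC addrACA.
    have := nmD S ((y : V) - lsubspace_val v) ((x : V) - lsubspace_val w); lra.
  rewrite -ler_pdivrMl//; apply: lb_le_inf => // _ [w _ <-].
  rewrite ler_pdivrMl//; apply: le_trans (ple _ (ofR t *: w)) _.
  have -> : phi (ofR t *: w) = ofR t * phi w by rewrite linearZ.
  rewrite re_ofRM restrict_scalarsE.
  have -> : lsubspace_val (ofR t *: w) = ofR t *: lsubspace_val w by [].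
  rewrite -scalerBr nmZ.
  by rewrite nm_ofR gtr0_norm// mulrDr.
have [f [fD fZ fp]] := hahn_banach sp.
have fle (x : V) : f x <= nm x.
  apply: le_trans (fp _) _; have := ple x 0.
  by rewrite (linear0 phi) (linear0 (@lsubspace_val K V W)) subr0 (re0 S) addr0.
have fN x : f (- x) = - f x.
  have := fZ (-1) x; rewrite restrict_scalarsE rmorphN1 scaleN1r mulN1r//.
have fphi w : f (lsubspace_val w) = re S (phi w).
  have le v : f (lsubspace_val v) <= re S (phi v).
    by apply: le_trans (fp _) _; apply: le_trans (ple _ v) _; rewrite subrr nm0 add0r.
  apply/eqP; rewrite eq_le le /=.
  by have := le (- w); rewrite (linearN phi) reN (linearN (@lsubspace_val K V W)) fN lerN2.
have cl := complexify_linear fD fZ.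
exists (pack_linear cl); split=> [w|x] /=.
  have hZ : iunit S *: lsubspace_val w = lsubspace_val (iunit S *: w) by [].
  have pZ : phi (iunit S *: w) = iunit S * phi w by rewrite linearZ.
  by rewrite /complexify hZ !fphi pZ; exact/esym/reM_ofRl.
set F := pack_linear cl; have -> : complexify f x = F x by [].
have reF y : re S (F y) = f y.
  by rewrite /F /= /complexify reD ofRK -mulrN -rmorphN re_iunitM im_ofR oppr0 addr0.
have [->|Fx0] := eqVneq (F x) 0; first by rewrite nm0 nm_ge0.
(* A scalar of modulus 1 that makes the value real and nonnegative, so that the bound on the real
   part [f] bounds [nm (F x)]. *)
pose th := (F x)^-1 * ofR (nm (F x)).
have Fth : F (th *: x) = ofR (nm (F x)).
  by rewrite linearZ /= /th -[LHS]/(_ * _) mulrAC mulVf// mul1r.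
have -> : nm (F x) = re S (F (th *: x)) by rewrite Fth ofRK.
rewrite reF; apply: le_trans (fle _) _; rewrite nmZ ler_piMl ?nm_ge0//.
have nF : nm (F x) != 0 by rewrite nm_eq0.
rewrite -(ler_pM2l (x := nm (F x))) ?lt_neqAle ?nm_ge0 1?eq_sym ?nF//.
by rewrite -nmM /th mulrA mulfV// mul1r nm_ofR ger0_norm ?nm_ge0// mulr1.
Qed.

End Extension.

(** * Limits along ultrafilters *)

Section UltraLimit.
Variables (R : realType) (K : numFieldType) (S : scalar_parts R K).
Local Notation nm := (nm S).
Local Notation ofR := (ofR S).
Variables (T : Type) (U : set_system T) (UU : UltraFilter U).

Definition ulim (f : T -> K) (l : K) :=
  forall e, 0 < e -> U [set t | nm (f t - l) <= e].

(** The limit is the supremum of the numbers that [g] eventually dominates; the ultrafilter excludes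
    that [g] stays above it by [e]. *)
Let real_ulim_ex (g : T -> R) (M : R) : U [set t | `|g t| <= M] ->
  exists l, forall e, 0 < e -> U [set t | `|g t - l| <= e].
Proof.
move=> gM; pose A := [set r | U [set t | r <= g t]].
have A0 : A (- M).
  by apply: filterS gM => t /=; rewrite ler_norml => /andP[].
have Aub : ubound A M.
  move=> r Ar; have [t [/= rt]] := filter_ex (filterI Ar gM).
  by rewrite ler_norml => /andP[_]; exact: le_trans.
have hA : has_sup A by split; [exists (- M)|exists M].
exists (sup A) => e e0.
have lo : U [set t | sup A - e <= g t].
  have [r Ar rs] := sup_adherent e0 hA.
  by apply: filterS Ar => t /=; apply: le_trans; exact: ltW.
have hi : U [set t | g t <= sup A + e].
  have [h|h] := in_ultra_setVsetC [set t | sup A + e <= g t] UU.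
    have : sup A + e <= sup A by apply: ub_le_sup => //; exists M.
    by rewrite gerDl leNgt e0.
  by apply: filterS h => t /= /negP; rewrite -ltNge => /ltW.
apply: filterS (filterI lo hi) => t /= [h1 h2].
by rewrite ler_distl h1 h2.
Qed.

Lemma ulim_ex (f : T -> K) (M : R) : U [set t | nm (f t) <= M] ->
  exists l, ulim f l.
Proof.
move=> fM.
have [|a aP] := @real_ulim_ex (re S \o f) M.
  by apply: filterS fM => t /=; apply: le_trans; exact: norm_re_le.
have [|b bP] := @real_ulim_ex (im S \o f) M.
  by apply: filterS fM => t /=; apply: le_trans; exact: norm_im_le.
exists (ofR a + iunit S * ofR b) => e e0.
have e2 : 0 < e / 2 by rewrite divr_gt0.
apply: filterS (filterI (aP _ e2) (bP _ e2)) => t /= [ha hb].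
rewrite {1}(scalarE S (f t)) opprD addrACA -mulrBr -!rmorphB.
apply: le_trans (nmD _ _ _) _; rewrite nmM !nm_ofR [e]splitr lerD//.
apply: le_trans hb; rewrite ler_piMl//.
by rewrite -nm_le rmorph1 ler_norm_iunit.
Qed.

Lemma ulim_linear (a : K) f g l m : ulim f l -> ulim g m ->
  ulim (fun t => a * f t + g t) (a * l + m).
Proof.
move=> fl gm e e0.
have e2 : 0 < e / 2 by rewrite divr_gt0.
have a1 : 0 < 1 + nm a by rewrite ltr_pwDl// nm_ge0.
have e3 : 0 < e / 2 / (1 + nm a) by rewrite divr_gt0.
apply: filterS (filterI (fl _ e3) (gm _ e2)) => t /= [h1 h2].
rewrite opprD addrACA -mulrBr; apply: le_trans (nmD _ _ _) _.
rewrite [e]splitr lerD// nmM; move: h1; rewrite ler_pdivlMr//.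
apply: le_trans; rewrite mulrC ler_wpM2l ?nm_ge0//.
by rewrite lerDr.
Qed.

Lemma ulim_unique f l m : ulim f l -> ulim f m -> l = m.
Proof.
move=> fl fm; apply/eqP; rewrite -subr_eq0 -(nm_eq0 S) eq_le nm_ge0 andbT.
apply/ler_addgt0Pr => e e0; rewrite add0r.
have e2 : 0 < e / 2 by rewrite divr_gt0.
have [t [/= h1 h2]] := filter_ex (filterI (fl _ e2) (fm _ e2)).
have -> : l - m = (f t - m) - (f t - l) by rewrite opprB [RHS]addrC addrA subrK.
by rewrite [e]splitr; apply: le_trans (nmB _ _ _) _; rewrite lerD.
Qed.

Lemma eq_ulim f g l : U [set t | f t = g t] -> ulim f l -> ulim g l.
Proof.
by move=> fg fl e e0; apply: filterS (filterI fg (fl _ e0)) => t /= [->].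
Qed.

Lemma ulim_l2_le (I : finType) (f : T -> I -> K) (l c : I -> K) (B : R) :
  (forall i, ulim (f ^~ i) (l i)) ->
  U [set t | l2 S (fun i => f t i - c i) <= B] ->
  l2 S (fun i => l i - c i) <= B.
Proof.
move=> fl fB; apply/ler_addgt0Pr => e e0.
(* If each coordinate is within this distance, the [l2] distance is at most [e]; the [1 +] covers an
   empty [I]. *)
have e1 : 0 < e / (1 + #|I|%:R) by rewrite divr_gt0// ltr_pwDl.
have [t [/= tB tP]] :=
  filter_ex (filterI fB (filter_forall _ (fun i => fl i _ e1))).
have := l2D S (fun i => f t i - c i) (fun i => l i - f t i).
rewrite (@eq_l2 _ _ _ _ _ (fun i => l i - c i)); last first.
  by move=> i; rewrite [LHS]addrC addrA subrK.
move=> /le_trans; apply; apply: lerD => //.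
rewrite -(@ler_pXn2r _ 2)// ?nnegrE ?l2_ge0 ?(ltW e0)// sqr_l2.
apply: (@le_trans _ _ (\sum_(i : I) (e / (1 + #|I|%:R)) ^+ 2)).
  apply: ler_sum => i _; rewrite ler_pXn2r ?nnegrE ?nm_ge0 ?(ltW e1)//.
  by rewrite nmBC.
rewrite sumr_const -[leLHS]mulr_natl.
have -> : e ^+ 2 = (1 + #|I|%:R) ^+ 2 * (e / (1 + #|I|%:R)) ^+ 2.
  by rewrite -exprMn mulrC divfK// gt_eqF// ltr_pwDl.
rewrite ler_wpM2r ?sqr_ge0//.
have := ler0n R #|I|; nra.
Qed.

End UltraLimit.

(* Compactness: approximations on the finite subsets of [V] that are linear
   there and stay close to [phi] yield a linear map close to [phi]. *)
Lemma linear_approximation_compactness (R : realType) (K : numFieldType)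
    (S : scalar_parts R K) (V : lmodType K) (I : finType)
    (phi : V -> I -> K) (B : V -> R) :
  (forall s : seq V, exists w : V -> I -> K,
    (forall a x y i, x \in s -> y \in s -> a *: x + y \in s ->
      w (a *: x + y) i = a * w x i + w y i) /\
    (forall x, x \in s -> l2 S (fun i => w x i - phi x i) <= B x)) ->
  exists w : V -> I -> K,
    (forall a x y i, w (a *: x + y) i = a * w x i + w y i) /\
    (forall x, l2 S (fun i => w x i - phi x i) <= B x).
Proof.
move=> /choice[W WP].
(* The filter of all sufficiently large finite sets. Along a finer ultrafilter every instance of
   linearity holds eventually, since its three vectors eventually belong to [t]. *)
pose F0 : set_system (seq V) :=
  [set A | exists s : seq V, forall t : seq V, {subset s <= t} -> A t].
have F0F : ProperFilter F0.
  apply: Build_ProperFilter_ex; first by move=> A [s sA]; exists s; exact: sA.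
  split=> [|A B' [s sA] [t tB]|A B' AB [s sA]].
  - by exists [::].
  - exists (s ++ t) => v stv; split.
      by apply: sA => x xs; apply: stv; rewrite mem_cat xs.
    by apply: tB => x xt; apply: stv; rewrite mem_cat xt orbT.
  - by exists s => t /sA; exact: AB.
have [U [UU F0U]] := ultraFilterLemma F0F.
have mem (s : seq V) : U [set t : seq V | {subset s <= t}] by apply: F0U; exists s.
have wx_bounded x i : exists l, ulim S U (fun t => W t x i) l.
  apply: (@ulim_ex _ _ S _ U UU _ (B x + nm S (phi x i))).
  apply: filterS (mem [:: x]) => t /= xt.
  rewrite -[W t x i](subrK (phi x i)); apply: le_trans (nmD _ _ _) _.
  rewrite lerD2r; apply: le_trans ((WP t).2 x _); last by apply: xt; rewrite inE.
  exact: (nm_le_l2 S (fun i => W t x i - phi x i)).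
have wx_ex x : exists l : I -> K, forall i, ulim S U (fun t => W t x i) (l i).
  by have [l lP] := choice (wx_bounded x); exists l.
have [w wP] := choice wx_ex.
exists w; split=> [a x y i|x].
  apply: (ulim_unique UU (wP _ _)).
  apply: eq_ulim (ulim_linear UU a (wP x i) (wP y i)).
  apply: filterS (mem [:: x; y; a *: x + y]) => t /= st.
  by rewrite (WP t).1//; apply: st; rewrite !inE eqxx ?orbT.
apply: (ulim_l2_le UU (f := fun t => W t x)) => //.
apply: filterS (mem [:: x]) => t /= xt.
by apply: (WP t).2; apply: xt; rewrite inE.
Qed.

(** * The Hilbert space of square summable arrays *)

Section HilbertSpace.
Variables (R : realType) (K : numFieldType) (S : scalar_parts R K).
Local Notation nm := (nm S).
Local Notation ofR := (ofR S).
Local Notation array := (nat * nat -> K^o).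

(** Arrays have two indices so that row [n] can hold the [n]-th block of the final operator; the
    square corners exhaust the index set by finite families. *)
Definition corner (N : nat) (x : array) : R :=
  l2 S (fun p : 'I_N * 'I_N => x (val p.1, val p.2)).

Lemma corner_ge0 N x : 0 <= corner N x.
Proof. exact: l2_ge0. Qed.

Lemma sqr_corner N x :
  corner N x ^+ 2 = \sum_(i < N) \sum_(j < N) nm (x (val i, val j)) ^+ 2.
Proof. by rewrite sqr_l2 pair_big. Qed.

Lemma cornerD N x y : corner N (x + y) <= corner N x + corner N y.
Proof. exact: l2D. Qed.

Lemma cornerZ N a x : corner N (a *: x) = nm a * corner N x.
Proof. exact: l2Z. Qed.

Lemma corner_le N M x : (N <= M)%N -> corner N x <= corner M x.
Proof.
move=> NM; rewrite -(@ler_pXn2r _ 2)// ?nnegrE ?corner_ge0// !sqr_corner.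
have wid (f : nat -> R) : (forall i, 0 <= f i) ->
    \sum_(i < N) f i <= \sum_(i < M) f i.
  move=> f0; rewrite (big_ord_widen _ _ NM) big_mkcond; apply: ler_sum => i _.
  by case: ifP.
apply: le_trans (wid (fun i => \sum_(j < M) nm (x (i, val j)) ^+ 2) _).
  apply: ler_sum => i _; apply: (wid (fun j => nm (x (val i, j)) ^+ 2)) => j.
  exact: sqr_ge0.
by move=> i; apply: sumr_ge0 => j _; exact: sqr_ge0.
Qed.

Lemma nm_le_corner N x i j : (i < N)%N -> (j < N)%N -> nm (x (i, j)) <= corner N x.
Proof.
move=> iN jN.
exact: (nm_le_l2 S (fun p : 'I_N * 'I_N => x (val p.1, val p.2))
  (Ordinal iN, Ordinal jN)).
Qed.

Definition square_summable : {pred array} :=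
  fun x => `[< exists C, forall N, corner N x <= C >].

Lemma square_summable_closed : submod_closed square_summable.
Proof.
split=> [|a x y /asboolP[C xC] /asboolP[D yD]].
  by apply/asboolP; exists 0 => N; rewrite /corner l2_0.
apply/asboolP; exists (nm a * C + D) => N.
by apply: le_trans (cornerD _ _ _) _; rewrite cornerZ lerD// ler_wpM2l ?nm_ge0.
Qed.

HB.instance Definition _ :=
  GRing.isSubmodClosed.Build K array square_summable square_summable_closed.

Inductive hilbert : predArgType := Hilbert u & u \in square_summable.

Definition hilbert_val w : array := let: Hilbert u _ := w in u.

HB.instance Definition _ := [isSub of hilbert for hilbert_val].
HB.instance Definition _ := [Choice of hilbert by <:].
HB.instance Definition _ := [SubChoice_isSubZmodule of hilbert by <:].
HB.instance Definition _ := [SubZmodule_isSubLmodule of hilbert by <:].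

Definition hilbert_rnorm (x : hilbert) : R :=
  sup [set corner N (hilbert_val x) | N in [set: nat]].

Lemma corner_le_rnorm N x : corner N (hilbert_val x) <= hilbert_rnorm x.
Proof.
apply: ub_le_sup; last by exists N.
case: x => u /= /asboolP[C uC]; exists C => _ [M _ <-]; exact: uC.
Qed.

Lemma rnorm_le x C : (forall N, corner N (hilbert_val x) <= C) ->
  hilbert_rnorm x <= C.
Proof.
move=> xC; apply: ge_sup; first by exists (corner 0 (hilbert_val x)), 0%N.
by move=> _ [N _ <-]; exact: xC.
Qed.

Definition hilbert_norm (x : hilbert) : K := ofR (hilbert_rnorm x).

Let hilbert_ler_normD x y :
  hilbert_norm (x + y) <= hilbert_norm x + hilbert_norm y.
Proof.
rewrite -rmorphD ler_ofR; apply: rnorm_le => N.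
by apply: le_trans (cornerD _ _ _) _; rewrite lerD ?corner_le_rnorm.
Qed.

Let hilbert_normrZ (a : K) x : hilbert_norm (a *: x) = `|a| * hilbert_norm x.
Proof.
rewrite -(ofR_nm S) -rmorphM; congr (ofR _); apply/eqP; rewrite eq_le.
apply/andP; split.
  apply: rnorm_le => N; rewrite cornerZ ler_wpM2l ?nm_ge0//.
  exact: corner_le_rnorm.
have [->|a0] := eqVneq a 0.
  by rewrite nm0 mul0r; apply: le_trans (corner_le_rnorm 0 _); exact: corner_ge0.
have na0 : 0 < nm a by rewrite lt_neqAle nm_ge0 andbT eq_sym nm_eq0.
rewrite -ler_pdivlMl//; apply: rnorm_le => N.
rewrite ler_pdivlMl// -cornerZ; exact: (corner_le_rnorm N (a *: x)).
Qed.

Let hilbert_normr0_eq0 x : hilbert_norm x = 0 -> x = 0.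
Proof.
rewrite -(rmorph0 ofR) => /ofR_inj x0; apply/val_inj/funext => -[i j].
apply/eqP; rewrite -(nm_eq0 S) eq_le nm_ge0 andbT -x0.
apply: le_trans (corner_le_rnorm (maxn i j).+1 x).
by apply: nm_le_corner; rewrite ltnS ?leq_maxl ?leq_maxr.
Qed.

HB.instance Definition _ := Lmodule_isNormed.Build K hilbert
  hilbert_ler_normD hilbert_normrZ hilbert_normr0_eq0.

Lemma nm_hilbert (x : hilbert) : nm x = hilbert_rnorm x.
Proof. by rewrite /nm ofRK. Qed.

Lemma corner_le_nm N (x : hilbert) : corner N (hilbert_val x) <= nm x.
Proof. by rewrite nm_hilbert corner_le_rnorm. Qed.

Lemma nm_hilbert_le (x : hilbert) C :
  (forall N, corner N (hilbert_val x) <= C) -> nm x <= C.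
Proof. by rewrite nm_hilbert; exact: rnorm_le. Qed.

Lemma nm_coord_le (x : hilbert) p : nm (hilbert_val x p) <= nm x.
Proof.
case: p => i j; apply: le_trans (corner_le_nm (maxn i j).+1 x).
by apply: nm_le_corner; rewrite ltnS ?leq_maxl ?leq_maxr.
Qed.

(* The limit is found coordinatewise along an ultrafilter finer than [G]. *)
Let hilbert_complete (G : set_system hilbert) :
  ProperFilter G -> cauchy G -> cvg G.
Proof.
have third (a b c : R) : a <= c / 3 -> b <= c / 3 -> 0 < c -> a + b < c by lra.
move=> GF cG.
have ballE (x : hilbert) e z : 0 < e -> ball x (ofR e) z -> nm (z - x) <= e.
  move=> e0; rewrite -ball_normE /ball_ /= => /ltW.
  by rewrite nm_le nmBC.
have Gball e : 0 < e -> exists x, G [set z | nm (z - x) <= e].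
  move=> e0; have e0' : 0 < ofR e by rewrite -(rmorph0 ofR) ltr_ofR.
  have /cauchyP/(_ _ e0')[x Gx] := cG.
  by exists x; apply: filterS Gx => z; exact: ballE.
have [U [UU GU]] := ultraFilterLemma GF.
have coord p : exists l, ulim S U (fun z => hilbert_val z p) l.
  have [x Gx] := Gball _ ltr01.
  apply: (@ulim_ex _ _ S _ U UU _ (1 + nm x)).
  apply: filterS (GU _ Gx) => z /= zx.
  apply: le_trans (nm_coord_le _ _) _.
  by rewrite -[z](subrK x); apply: le_trans (nmD _ _ _) _; rewrite lerD2r.
have [l lP] := choice coord.
have lx e x N : G [set z | nm (z - x) <= e] ->
    corner N ((l : array) - hilbert_val x) <= e.
  move=> Gx; pose I := ('I_N * 'I_N)%type.
  apply: (@ulim_l2_le _ _ S _ U UU I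
    (fun z (p : I) => hilbert_val z (val p.1, val p.2))) => [p|].
    exact: lP.
  apply: filterS (GU _ Gx) => z /=; apply: le_trans.
  exact: (corner_le_nm N (z - x)).
have lin : l \in square_summable.
  have [x Gx] := Gball _ ltr01; apply/asboolP; exists (1 + nm x) => N.
  rewrite -[l](subrK (hilbert_val x)); apply: le_trans (cornerD _ _ _) _.
  by rewrite lerD ?corner_le_nm ?lx.
apply/cvg_ex; exists (Hilbert lin); apply/cvg_ballP => e e0.
have [eE re0] := nm_lt_gt0 S e0.
have e3 : 0 < re S e / 3 by rewrite divr_gt0.
have [x Gx] := Gball _ e3.
have hx : nm (Hilbert lin - x) <= re S e / 3.
  by apply: nm_hilbert_le => N; exact: lx.
apply: filterS Gx => z /= zx.
rewrite -ball_normE /ball_ /= eE -(ofR_nm S) ltr_ofR.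
have -> : Hilbert lin - z = (Hilbert lin - x) - (z - x).
  by rewrite opprB addrA subrK.
exact: le_lt_trans (nmB _ _ _) (third _ _ _ hx zx re0).
Qed.

HB.instance Definition _ := Uniform_isComplete.Build hilbert hilbert_complete.


Let Nu_ex : exists U : set_system nat, UltraFilter U /\ \oo `<=` U.
Proof. exact: ultraFilterLemma. Qed.

Let Nu : set_system nat := sval (cid Nu_ex).

Let Nu_ultra : UltraFilter Nu.
Proof. by case: (svalP (cid Nu_ex)). Qed.

Let Nu_oo A : \oo A -> Nu A.
Proof. by case: (svalP (cid Nu_ex)) => _; exact. Qed.

Let partial_dot (x y : hilbert) (N : nat) : K :=
  \sum_(p : 'I_N * 'I_N)
    hilbert_val x (val p.1, val p.2) * scalar_conj (hilbert_val y (val p.1, val p.2)).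

Let dot_ex (x y : hilbert) : exists l, ulim S Nu (partial_dot x y) l.
Proof.
apply: (@ulim_ex _ _ S _ Nu Nu_ultra _ (nm x * nm y)).
apply: Nu_oo; exists 0%N => // N _ /=.
apply: le_trans (nm_sumM_le _ _ _) _; rewrite ler_pM ?l2_ge0 ?corner_le_nm//.
apply: le_trans (corner_le_nm N y).
by rewrite /corner /l2; under eq_bigr do rewrite nm_scalar_conj.
Qed.

(** A limit along an ultrafilter exists as soon as the partial sums are bounded, which
    Cauchy-Schwarz gives, and it is linear without any discussion of summability. *)
Definition hilbert_dot (x y : hilbert) : K := sval (cid (dot_ex x y)).

Let hilbert_dotP x y : ulim S Nu (partial_dot x y) (hilbert_dot x y).
Proof. exact: svalP (cid (dot_ex x y)). Qed.

Let hilbert_dotC x y :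
  hilbert_dot x y = (-1) ^+ false * scalar_conj (hilbert_dot y x).
Proof.
have NF := Nu_ultra; rewrite expr0 mul1r; apply: (ulim_unique Nu_ultra (hilbert_dotP x y)) => e e0.
apply: filterS (hilbert_dotP y x e0) => N /=.
have -> : partial_dot x y N = scalar_conj (partial_dot y x N).
  rewrite /partial_dot (big_morph _ (scalar_conjD S) (id1 := 0)); last first.
    by rewrite -(rmorph0 ofR) (scalar_conj_ofR S).
  by apply: eq_bigr => p _; rewrite scalar_conjM (scalar_conjK S) mulrC.
by rewrite -(scalar_conjB S) nm_scalar_conj.
Qed.

Let hilbert_dotl a x y z :
  hilbert_dot (a *: x + y) z = a * hilbert_dot x z + hilbert_dot y z.
Proof.
apply: (ulim_unique Nu_ultra (hilbert_dotP _ _)).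
apply: (eq_ulim Nu_ultra) (ulim_linear Nu_ultra a (hilbert_dotP x z) (hilbert_dotP y z)).
apply: Nu_oo; exists 0%N => // N _ /=.
rewrite /partial_dot mulr_sumr -big_split; apply: eq_bigr => p _ /=.
by rewrite mulrA -mulrDl.
Qed.

Let hilbert_dotr a x y z :
  hilbert_dot z (a *: x + y) = scalar_conj a * hilbert_dot z x + hilbert_dot z y.
Proof.
rewrite !(hilbert_dotC z) !expr0 !mul1r hilbert_dotl (scalar_conjD S).
by rewrite scalar_conjM.
Qed.

Lemma hilbert_dotxx (x : hilbert) : hilbert_dot x x = `|x| ^+ 2.
Proof.
rewrite -(ofR_nm S) -rmorphXn.
apply: (ulim_unique Nu_ultra (hilbert_dotP _ _)) => e e0.
have n1 : 0 < 1 + nm x by rewrite ltr_pwDl// nm_ge0.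
(* With [d] this quantity, [m] the norm and [c] a corner with [m - d <= c <= m], one has
   [m ^+ 2 - c ^+ 2 <= 2 * m * d <= e]. *)
have d0 : 0 < e / (2 * (1 + nm x)) by rewrite divr_gt0// mulr_gt0.
have [N0 hN0] : exists N, nm x - e / (2 * (1 + nm x)) < corner N (hilbert_val x).
  apply: contrapT => nN.
  have : nm x <= nm x - e / (2 * (1 + nm x)).
    apply: nm_hilbert_le => N; rewrite leNgt; apply/negP => h.
    by apply: nN; exists N.
  by rewrite lerDl oppr_ge0 leNgt d0.
apply: Nu_oo; exists N0 => // N /= N0N.
have -> : partial_dot x x N = ofR (corner N (hilbert_val x) ^+ 2).
  rewrite sqr_l2 rmorph_sum; apply: eq_bigr => p _.
  exact: mul_scalar_conj.
rewrite -rmorphB nm_ofR distrC.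
have h1 : nm x - e / (2 * (1 + nm x)) <= corner N (hilbert_val x).
  by apply: le_trans (ltW hN0) _; exact: corner_le.
have h2 := corner_le_nm N x.
have h3 := corner_ge0 N (hilbert_val x).
have h4 : e / (2 * (1 + nm x)) * (2 * (1 + nm x)) = e.
  by rewrite divfK// gt_eqF// mulr_gt0.
move: h1 h2 h3 h4 n1 d0; set d := e / _; set c := corner _ _; set m := nm x.
move=> h1 h2 h3 h4 n1 d0.
rewrite ger0_norm; last by rewrite subr_ge0 ler_pXn2r ?nnegrE// (le_trans h3).
by rewrite subr_sqr; nra.
Qed.

Let hilbert_dot0l z : hilbert_dot 0 z = 0.
Proof. by have := hilbert_dotl (-1) 0 0 z; rewrite scaleN1r addNr mulN1r addNr. Qed.

Let hilbert_dot0r z : hilbert_dot z 0 = 0.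
Proof.
by rewrite hilbert_dotC expr0 mul1r hilbert_dot0l /scalar_conj invr0 mulr0.
Qed.

Let hilbert_dotBl z : zmod_morphism (hilbert_dot ^~ z).
Proof.
by move=> x y; rewrite -[x - y]addrC -scaleN1r hilbert_dotl mulN1r addrC.
Qed.

Let hilbert_dotBr z : zmod_morphism (hilbert_dot z).
Proof.
move=> x y; rewrite -[x - y]addrC -scaleN1r hilbert_dotr -{1}(rmorphN1 ofR).
by rewrite scalar_conj_ofR rmorphN1 mulN1r addrC.
Qed.

Let hilbert_dotZl z : scalable_for *%R (hilbert_dot ^~ z).
Proof. by move=> a x; rewrite -[a *: x]addr0 hilbert_dotl hilbert_dot0l addr0. Qed.

Let hilbert_dotZr z : scalable_for (@scalar_conj K \; *%R) (hilbert_dot z).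
Proof. by move=> a x; rewrite -[a *: x]addr0 hilbert_dotr hilbert_dot0r addr0. Qed.

HB.instance Definition _ := isBilinear.Build K hilbert hilbert K
  *%R (@scalar_conj K \; *%R) hilbert_dot
  hilbert_dotBl hilbert_dotBr hilbert_dotZl hilbert_dotZr.

HB.instance Definition _ := isHermitianSesquilinear.Build K hilbert false
  (@scalar_conj K) hilbert_dot hilbert_dotC.

Let hilbert_dot_gt0 x : x != 0 -> 0 < hilbert_dot x x.
Proof. by move=> x0; rewrite hilbert_dotxx exprn_gt0// normr_gt0. Qed.

HB.instance Definition _ := isDotProduct.Build K hilbert hilbert_dot
  hilbert_dot_gt0.

Lemma hilbert_is_hilbert : is_hilbert hilbert.
Proof. by exists hilbert_dot; exact: hilbert_dotxx. Qed.

End HilbertSpace.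

(** * Operator norms and Banach-Mazur distances *)

Section OperatorNorm.
Variables (R : realType) (K : numFieldType) (S : scalar_parts R K).
Local Notation nm := (nm S).
Local Notation ofR := (ofR S).

(** [supremum] is meaningful only if a least upper bound exists in [K]. Nonnegative elements lie in
    the image of [ofR], so the real supremum provides one. *)
Lemma le_supremum (A : set K) (c : K) : (forall a, A a -> 0 <= a) ->
  (forall a, A a -> a <= c) -> forall a, A a -> a <= supremum 0 A.
Proof.
move=> A0 Ac a Aa; rewrite /supremum.
have -> : (A == set0) = false by apply/negP => /eqP E; rewrite E in Aa.
pose B := [set re S a | a in A].
have ge0E x : A x -> x = ofR (re S x) by move=> /A0; exact: ge0_ofR.
have leE x b : A x -> x <= b -> re S x <= re S b.
  move=> Ax xb; rewrite -(ler_ofR S) -(ge0E _ Ax) -(ge0_ofR S) //.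
  exact: le_trans (A0 _ Ax) xb.
have hB : has_sup B.
  split; first by exists (re S a), a.
  by exists (re S c) => _ [x Ax <-]; apply: leE => //; exact: Ac.
suff [h _] : supremums A (xget 0 (supremums A)) by exact: h.
apply: xgetPex; exists (ofR (sup B)); split=> [x Ax|b bub].
  by rewrite (ge0E _ Ax) ler_ofR; apply: ub_le_sup; [exact: hB.2|exists x].
have b0 : 0 <= b by apply: le_trans (bub _ Aa); exact: A0.
rewrite (ge0_ofR S b0) ler_ofR; apply: ge_sup; first exact: hB.1.
by move=> _ [x Ax <-]; apply: leE => //; exact: bub.
Qed.

(** The hypothesis [0 <= c] covers the default value [0], taken for an empty set or a missing
    supremum. *)
Lemma supremum_le (A : set K) (c : K) : 0 <= c ->
  (forall a, A a -> a <= c) -> supremum 0 A <= c.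
Proof.
move=> c0 Ac; rewrite /supremum; case: ifP => // _.
by case: xgetP => // x _ [_]; apply.
Qed.

Lemma infimum_lt (A : set K) (c : K) : A !=set0 -> (forall a, A a -> 0 <= a) ->
  infimum 0 A <= c -> exists2 a, A a & re S a <= re S c + 1.
Proof.
move=> [a Aa] A0; rewrite /infimum.
have -> : (A == set0) = false by apply/negP => /eqP E; rewrite E in Aa.
pose B := [set re S a | a in A].
have B0 : lbound B 0.
  by move=> _ [x Ax <-]; rewrite -(ofR_ge0 S) -(ge0_ofR S) //; exact: A0.
have hB : has_inf B by split; [exists (re S a), a|exists 0].
have [_ h] : infimums A (xget 0 (infimums A)).
  apply: xgetPex; exists (ofR (inf B)); split=> [x Ax|b blb].
    rewrite (ge0_ofR S (A0 _ Ax)) ler_ofR.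
    by apply: ge_inf; [exact: hB.2|exists x].
  have bx x : A x -> b <= ofR (re S x) by move=> Ax; rewrite -ge0_ofR ?blb ?A0.
  (* A lower bound need not be nonnegative, but its difference from a real element above it is, so
     it is real as well. *)
  have bE : b = ofR (re S b).
    have := bx _ Aa; rewrite -subr_ge0 => /(ge0_ofR S) E.
    rewrite -[b](subKr (ofR (re S a))) E -rmorphB.
    by rewrite ofRK.
  rewrite bE ler_ofR; apply: lb_le_inf; first exact: hB.1.
  by move=> _ [x Ax <-]; rewrite -(ler_ofR S) -bE bx.
have inf_le : ofR (inf B) <= xget 0 (infimums A).
  apply: h => x Ax; rewrite (ge0_ofR S (A0 _ Ax)) ler_ofR.
  by apply: ge_inf; [exact: hB.2|exists x].
move=> ic; have {h inf_le ic} ic := le_trans inf_le ic.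
have inf0 : 0 <= inf B by apply: lb_le_inf => //; exact: hB.1.
have c0 : 0 <= c by apply: le_trans ic; rewrite ofR_ge0.
move: ic; rewrite (ge0_ofR S c0) ler_ofR => ic.
have [_ [x Ax <-] xi] := inf_adherent ltr01 hB.
by exists x => //; rewrite ofRK; lra.
Qed.

Section Ops.
Variables X Y : normedModType K.
Implicit Types f : {linear X -> Y}.

Lemma bounded_opP f : bounded_op f ->
  exists2 M, 0 <= M & forall x, nm (f x) <= M * nm x.
Proof.
move=> /linear_boundedP/pinfty_ex_gt0[M M0 fM].
have [ME M0'] := nm_lt_gt0 S M0.
exists (re S M); first exact: ltW.
by move=> x; rewrite -nm_le rmorphM /= ofR_nm -ME.
Qed.

Lemma bounded_opI f M : (forall x, nm (f x) <= M * nm x) -> bounded_op f.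
Proof.
move=> fM; apply/linear_boundedP; near=> r => x.
apply: (@le_trans _ _ (ofR `|M| * `|x|)).
  rewrite -(ofR_nm S x) -rmorphM nm_le; apply: le_trans (fM x) _.
  by rewrite ler_wpM2r ?nm_ge0// ler_norm.
rewrite ler_wpM2r//; near: r; apply: nbhs_pinfty_ge.
by rewrite ger0_real// ofR_ge0.
Unshelve. all: by end_near. Qed.

Let unit_values f := [set `|f x| | x in [set x : X | `|x| <= 1]].

Lemma opnorm_ge0 f : bounded_op f -> 0 <= opnorm f.
Proof.
move=> bf; have [M M0 fM] := bounded_opP bf.
have h : unit_values f `|f 0| by exists 0 => //=; rewrite normr0.
apply: le_trans (normr_ge0 (f 0)) _.
apply: (@le_supremum _ (ofR M)) h => [_ [x _ <-]//|_ [x /= x1 <-]].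
rewrite nm_le; apply: le_trans (fM x) _.
by rewrite ler_piMr// -nm_le rmorph1.
Qed.

Lemma le_opnorm f x : bounded_op f -> nm (f x) <= re S (opnorm f) * nm x.
Proof.
move=> bf; have [M M0 fM] := bounded_opP bf.
have oE := ge0_ofR S (opnorm_ge0 bf).
have [->|x0] := eqVneq x 0; first by rewrite linear0 !nm0 mulr0.
have nx0 : 0 < nm x by rewrite lt_neqAle nm_ge0 andbT eq_sym nm_eq0.
have h : unit_values f `|f (ofR (nm x)^-1 *: x)|.
  exists (ofR (nm x)^-1 *: x) => //=.
  by rewrite -(rmorph1 ofR) nm_le nmZ nm_ofR gtr0_norm ?invr_gt0// mulVf ?gt_eqF.
have : `|f (ofR (nm x)^-1 *: x)| <= ofR (re S (opnorm f)).
  rewrite -oE; apply: (@le_supremum _ (ofR M)) h => [_ [y _ <-]//|_ [y /= y1 <-]].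
  rewrite nm_le; apply: le_trans (fM y) _.
  by rewrite ler_piMr// -nm_le rmorph1.
rewrite nm_le linearZ nmZ nm_ofR gtr0_norm ?invr_gt0//.
by rewrite ler_pdivrMl// mulrC.
Qed.

End Ops.

Lemma bm_dist_leP (X Y : normedModType K) c : bm_dist_le X Y c ->
  exists (f : {linear X -> Y}) (g : {linear Y -> X}) (a b : R),
    [/\ cancel f g, cancel g f, forall x, nm (f x) <= a * nm x,
        forall y, nm (g y) <= b * nm y & [/\ 0 <= a, 0 <= b & a * b <= re S c + 1]].
Proof.
move=> [ne le_c].
have [|_ [f [g [bf bg fg gf ->]]] fgc] := infimum_lt ne _ le_c.
  by move=> _ [f [g [bf bg _ _ ->]]]; rewrite mulr_ge0// opnorm_ge0.
have fE := ge0_ofR S (opnorm_ge0 bf); have gE := ge0_ofR S (opnorm_ge0 bg).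
exists f, g, (re S (opnorm f)), (re S (opnorm g)); split=> //.
- by move=> x; exact: le_opnorm.
- by move=> x; exact: le_opnorm.
split; first by rewrite -(ofR_ge0 S) -fE opnorm_ge0.
  by rewrite -(ofR_ge0 S) -gE opnorm_ge0.
by rewrite -re_ofRM -fE.
Qed.

Lemma nm_linf_coord n (v : linf K n) j : nm ((v : 'rV[K]_n) 0 j) <= nm v.
Proof.
rewrite -nm_le ofR_nm [leRHS]/Num.Def.normr /= mx_normE -[leLHS]nngE num_le.
exact: (le_bigmax _ (fun i : 'I_1 * 'I_n => `|(v : 'rV[K]_n) i.1 i.2|%:nng) (0, j)).
Qed.

Lemma nm_linf_le n (v : linf K n) c : 0 <= c ->
  (forall j, nm ((v : 'rV[K]_n) 0 j) <= c) -> nm v <= c.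
Proof.
move=> c0 vc; have [->|v0] := eqVneq (nm v) 0; first by [].
have : mx_norm (v : 'rV[K]_n) != 0.
  by move: v0; rewrite nm_eq0 -normr_eq0.
move=> /mx_norm_neq0[[i j]] /= E.
rewrite -nm_le [leLHS]/Num.Def.normr /= E (ord1 i) nm_le; exact: vc.
Qed.

(** Rescaling by the norm bound [a] of [f] puts the whole distortion on [g]: the coordinates of
    [f / a] have norm at most 1 on [En] and extend to [E] by Hahn-Banach. The infimum may not be
    attained, whence [D = re C + 1]. *)
Lemma contains_linf_uniformlyP (E : completeNormedModType K) :
  contains_linf_uniformly E ->
  exists2 D, 0 <= D & forall n, (1 <= n)%N ->
    exists (g : {linear linf K n -> E}) (p : 'I_n -> {linear E -> K^o}),
    [/\ forall v j, p j (g v) = (v : 'rV[K]_n) 0 j,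
        forall v, nm (g v) <= D * nm v & forall j y, nm (p j y) <= nm y].
Proof.
(* The case [n = 1] shows that [D] is nonnegative. *)
move=> [C CP]; have [En1 /bm_dist_leP[_ [_ [a [b [_ _ _ _ [a0 b0 ab]]]]]]] := CP 1%N isT.
exists (re S C + 1); first by apply: le_trans ab; rewrite mulr_ge0.
move=> {En1 a b a0 b0 ab} n n1.
have [En /bm_dist_leP[f [g [a [b [fg gf fa gb [a0 b0 ab]]]]]]] := CP n n1.
have ap : 0 < a.
  rewrite lt_neqAle a0 andbT eq_sym; apply/eqP => az.
  have h (v : linf K n) : v = 0.
    rewrite -(gf v); apply/eqP; rewrite -(nm_eq0 S) eq_le nm_ge0 andbT.
    by rewrite -(mul0r (nm (g v))) -az fa.
  have := congr1 (fun v : 'rV[K]_n => v 0 (Ordinal n1)) (h (const_mx 1)).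
  by rewrite !mxE => /eqP; rewrite oner_eq0.
have lg : linear (fun v : linf K n => ofR a *: lsubspace_val (g v) : E).
  move=> c v w; have -> : g (c *: v + w) = c *: g v + g w by rewrite linearP.
  by rewrite [lsubspace_val _]lsubspace_val_linear scalerDr !scalerA [ofR a * c]mulrC.
have lp j : linear (fun w : lsubspace_of En => ofR a^-1 * (f w : 'rV[K]_n) 0 j : K^o).
  move=> c v w; have -> : f (c *: v + w) = c *: f v + f w by rewrite linearP.
  by rewrite !mxE mulrDr mulrCA.
have pj j : forall w, nm (pack_linear (lp j) w) <= nm (lsubspace_val w).
  move=> w /=; rewrite nmM nm_ofR gtr0_norm ?invr_gt0// ler_pdivrMl//.
  exact: le_trans (nm_linf_coord _ _) (fa _).
have [p pP] := choice (fun j => hahn_banach_extension (pj j)).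
exists (pack_linear lg), p; split=> [v j|v|j y] /=.
- have -> : p j (ofR a *: lsubspace_val (g v)) = ofR a * p j (lsubspace_val (g v)).
    by rewrite linearZ.
  rewrite (pP j).1 /= gf mulrA -rmorphM divff ?gt_eqF// rmorph1 mul1r//.
- rewrite nmZ nm_ofR gtr0_norm//; apply: (@le_trans _ _ (a * (b * nm v))).
    by rewrite ler_pM2l// -nm_lsubspace.
  by rewrite mulrA ler_wpM2r ?nm_ge0.
- exact: (pP j).2.
Qed.

End OperatorNorm.

(** * Finite spans and the local structure of L1-spaces *)

Section FiniteSpan.
Variables (K : numFieldType) (V : lmodType K).

Lemma lsubspaceP (G : lsubspace V) a x y : x \in G -> y \in G -> a *: x + y \in G.
Proof. by move=> xG yG; have [_] := lsubspace_closed G; apply. Qed.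

Lemma lsubspace0 (G : lsubspace V) : 0 \in G.
Proof. by have [] := lsubspace_closed G. Qed.

Lemma lsubspaceZ (G : lsubspace V) a x : x \in G -> a *: x \in G.
Proof. by move=> xG; rewrite -[_ *: _]addr0 lsubspaceP// lsubspace0. Qed.

Definition add_line_pred (G : lsubspace V) (x : V) : {pred V} :=
  fun y => `[< exists c, y - c *: x \in G >].

Lemma add_line_closed G x : submod_closed (add_line_pred G x).
Proof.
split=> [|a y z /asboolP[c yc] /asboolP[d zd]]; apply/asboolP.
  by exists 0; rewrite scale0r subr0 lsubspace0.
exists (a * c + d).
have -> : a *: y + z - (a * c + d) *: x = a *: (y - c *: x) + (z - d *: x).
  by rewrite scalerBr addrACA -opprD scalerDl scalerA.
exact: lsubspaceP.
Qed.

Definition add_line G x := LSubspace (add_line_closed G x).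

Lemma finite_dim_add_line G x : finite_dim G -> finite_dim (add_line G x).
Proof.
move=> [n [e [eG e0]]]; have [xG|xG] := pselect (x \in G).
  exists n, e; split=> // y; rewrite -(eG y).
  split=> [/asboolP[c yc]|yG]; last first.
    by apply/asboolP; exists 0; rewrite scale0r subr0.
  by rewrite -[y](subrK (c *: x)) addrC lsubspaceP.
pose e' (i : 'I_n.+1) := if unlift ord0 i is Some j then e j else x.
have sumE (a : 'I_n.+1 -> K) : \sum_(i < n.+1) a i *: e' i =
    a ord0 *: x + \sum_(i < n) a (lift ord0 i) *: e i.
  rewrite big_ord_recl /e' unlift_none; congr (_ + _).
  by apply: eq_bigr => i _; rewrite liftK.
exists n.+1, e'; split=> [y|a].
  split=> [/asboolP[c /eG[a ya]]|[a ->]].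
    exists (fun i => if unlift ord0 i is Some j then a j else c).
    rewrite sumE unlift_none; under eq_bigr do rewrite liftK.
    by rewrite -ya addrC subrK.
  apply/asboolP; exists (a ord0); rewrite sumE addrAC subrr add0r.
  by apply/eG; exists (fun i => a (lift ord0 i)).
rewrite sumE => a0.
have sG : \sum_(i < n) a (lift ord0 i) *: e i \in G.
  by apply/eG; exists (fun i => a (lift ord0 i)).
have a00 : a ord0 = 0.
  apply/eqP/negPn/negP => an0; apply: xG.
  have -> : x = - (a ord0)^-1 *: \sum_(i < n) a (lift ord0 i) *: e i.
    move/eqP: a0; rewrite addr_eq0 => /eqP/(congr1 (fun y => (a ord0)^-1 *: y)).
    by rewrite scalerA mulVf// scale1r scalerN scaleNr.
  exact: lsubspaceZ.
move: a0; rewrite a00 scale0r add0r => /e0 al i.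
by case: (unliftP ord0 i) => [j ->|->].
Qed.

Lemma finite_dim_span (s : seq V) :
  exists G : lsubspace V, finite_dim G /\ {subset s <= G}.
Proof.
elim: s => [|x s [G [fG sG]]].
  have c0 : submod_closed (pred1 (0 : V)).
    split=> [|a y z]; first by rewrite !inE.
    by rewrite !inE => /eqP-> /eqP->; rewrite scaler0 addr0.
  exists (LSubspace c0); split=> //; exists 0%N, (fun=> 0); split=> [y|a _ []//].
  split=> [|[a ->]]; last by rewrite big_ord0 inE.
  by rewrite inE => /eqP ->; exists (fun=> 0); rewrite big_ord0.
exists (add_line G x); split; first exact: finite_dim_add_line.
move=> y; rewrite inE => /orP[/eqP->|/sG yG]; apply/asboolP.
  by exists 1; rewrite scale1r subrr lsubspace0.
by exists 0; rewrite scale0r subr0.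
Qed.

End FiniteSpan.

Section L1Local.
Variables (R : realType) (K : numFieldType) (S : scalar_parts R K).
Local Notation nm := (nm S).
Local Notation ofR := (ofR S).

Lemma nm_l1 n (v : l1 K n) : nm v = \sum_(i < n) nm ((v : 'rV[K]_n) 0 i).
Proof.
apply: (@ofR_inj _ _ S); rewrite ofR_nm rmorph_sum.
by apply: eq_bigr => i _; rewrite /= ofR_nm.
Qed.

(** [e] consists of the images in [Fa] of the unit vectors of [l1], and [a x] of the coordinates of
    [x]. Since [nm (e i)] is at most the norm bound of [g], the weighted sum is at most the
    distortion times [nm x]. *)
Lemma script_L1_local (F : completeNormedModType K) : script_L1_space F ->
  exists2 C, 0 <= C & forall s : seq F,
    exists (n : nat) (e : 'I_n -> F) (a : F -> 'I_n -> K),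
    [/\ forall c x y i, x \in s -> y \in s -> c *: x + y \in s ->
          a (c *: x + y) i = c * a x i + a y i,
        forall x, x \in s -> x = \sum_(i < n) a x i *: e i &
        forall x, x \in s -> \sum_(i < n) nm (a x i) * nm (e i) <= C * nm x].
Proof.
move=> [sg sg1 FP].
have C0 : 0 <= re S sg + 1.
  have : 0 <= sg by exact: le_trans sg1.
  by move=> h; rewrite addr_ge0// -(ofR_ge0 S) -(ge0_ofR S).
exists (re S sg + 1) => // s.
have [G [/FP[Fa [n [GFa _ bm]]] sG]] := finite_dim_span s.
have [f [g [a [b [fg gf fa gb [a0 b0 ab]]]]]] := bm_dist_leP S bm.
pose d (i : 'I_n) : l1 K n := delta_mx 0 i.
(* [insubd] sends vectors outside [Fa] to [0]; only those of [s] matter. *)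
pose fx x : 'rV[K]_n := f (insubd (0 : lsubspace_of Fa) x).
have sFa x : x \in s -> x \in Fa by move=> /sG/GFa.
have valE x : x \in s -> lsubspace_val (insubd (0 : lsubspace_of Fa) x) = x.
  by move=> /sFa xFa; rewrite -[lsubspace_val _]/(\val _) insubdK.
have sumd (v : l1 K n) : v = \sum_(i < n) (v : 'rV[K]_n) 0 i *: d i.
  exact: (row_sum_delta (v : 'rV[K]_n)).
exists n, (fun i => lsubspace_val (g (d i))), (fun x i => fx x 0 i); split.
- move=> c x y i xs ys xys; rewrite /fx.
  have -> : insubd (0 : lsubspace_of Fa) (c *: x + y) =
      c *: insubd (0 : lsubspace_of Fa) x + insubd (0 : lsubspace_of Fa) y.
    apply: val_inj; rewrite /= [LHS]valE// [RHS]lsubspace_val_linear.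
    by rewrite !valE.
  by rewrite linearP !mxE.
- move=> x xs; rewrite -{1}(valE x xs) -{1}(fg (insubd _ x)).
  rewrite {1}(sumd (f _)) linear_sum linear_sum; apply: eq_bigr => i _.
  by rewrite linearZ.
- move=> x xs; apply: (@le_trans _ _ (\sum_(i < n) nm (fx x 0 i) * b)).
    apply: ler_sum => i _; rewrite ler_wpM2l ?nm_ge0//.
    rewrite -nm_lsubspace; apply: le_trans (gb _) _.
    rewrite ler_piMr// nm_l1 (bigD1 i)//= mxE !eqxx nm1 big1 ?addr0//.
    by move=> j ji; rewrite mxE (negPf ji) andbF nm0.
  rewrite -mulr_suml -(nm_l1 (fx x)).
  apply: (@le_trans _ _ (a * nm x * b)).
    rewrite ler_wpM2r//; apply: le_trans (fa _) _.
    by rewrite nm_lsubspace valE.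
  by rewrite mulrAC ler_wpM2r ?nm_ge0.
Qed.

End L1Local.

(** * The Kalton-Peck map *)

Section KaltonPeck.
Variables (R : realType) (K : numFieldType) (S : scalar_parts R K).
Variable I : finType.
Local Notation nm := (nm S).
Local Notation ofR := (ofR S).
Local Notation l2 := (l2 S).
Implicit Types x y v : I -> K.

(* For [y i = 0] the junk value of the logarithm is multiplied by [0]. *)
Definition kalton_peck y (i : I) : K := ofR (ln (nm (y i) / l2 y)) * y i.

Lemma norm_ln_le (t : R) : 0 < t -> `|ln t| <= t + t^-1.
Proof.
move=> t0; have tV : 0 < t^-1 by rewrite invr_gt0.
have := ln_sublinear t0; have := ln_sublinear tV; rewrite lnV ?posrE// => h1 h2.
rewrite ler_norml; apply/andP; split; lra.
Qed.

Lemma kalton_peck0 y i : l2 y = 0 -> kalton_peck y i = 0.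
Proof. by move=> /l2_eq0 y0; rewrite /kalton_peck y0 mulr0. Qed.

(** In coordinate [i] the difference is [y i * v i * ln t], where [t] is the ratio of
    [nm (y i) / l2 y] to [nm (v i) / l2 v]. By [norm_ln_le] it is at most
    [nm (y i) * nm (v i) * (t + t^-1)], that is [nm (y i) ^+ 2 * (l2 v / l2 y) + nm (v i) ^+ 2 * (l2
    y / l2 v)], and each of these terms sums to [l2 y * l2 v]. *)
Lemma kalton_peck_symmetric y v :
  nm (\sum_i (kalton_peck y i * v i - y i * kalton_peck v i)) <= 2 * l2 y * l2 v.
Proof.
have [y0|yn0] := eqVneq (l2 y) 0.
  rewrite big1 ?nm0 ?mulr_ge0 ?l2_ge0// => i _.
  by rewrite kalton_peck0// (l2_eq0 y0) !mul0r subrr.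
have [v0|vn0] := eqVneq (l2 v) 0.
  rewrite big1 ?nm0 ?mulr_ge0 ?l2_ge0// => i _.
  by rewrite (kalton_peck0 _ v0) (l2_eq0 v0) !mulr0 subrr.
have Y0 : 0 < l2 y by rewrite lt_neqAle eq_sym yn0 l2_ge0.
have V0 : 0 < l2 v by rewrite lt_neqAle eq_sym vn0 l2_ge0.
have -> : 2 * l2 y * l2 v =
    l2 y ^+ 2 * (l2 v / l2 y) + l2 v ^+ 2 * (l2 y / l2 v).
  by field; rewrite yn0 vn0.
rewrite !sqr_l2 !mulr_suml -big_split; apply: le_trans (nm_sum _ _ _ _) _.
apply: ler_sum => i _ /=.
have rhs0 : 0 <= nm (y i) ^+ 2 * (l2 v / l2 y) + nm (v i) ^+ 2 * (l2 y / l2 v).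
  by rewrite addr_ge0// mulr_ge0 ?sqr_ge0// divr_ge0// ltW.
have [yi0|yi0] := eqVneq (y i) 0.
  suff -> : kalton_peck y i * v i - y i * kalton_peck v i = 0 by rewrite nm0.
  by rewrite /kalton_peck yi0 !(mulr0, mul0r) subrr.
have [vi0|vi0] := eqVneq (v i) 0.
  suff -> : kalton_peck y i * v i - y i * kalton_peck v i = 0 by rewrite nm0.
  by rewrite /kalton_peck vi0 !(mulr0, mul0r) subrr.
have ny0 : 0 < nm (y i) by rewrite lt_neqAle nm_ge0 andbT eq_sym nm_eq0.
have nv0 : 0 < nm (v i) by rewrite lt_neqAle nm_ge0 andbT eq_sym nm_eq0.
have -> : kalton_peck y i * v i - y i * kalton_peck v i =
    y i * v i * ofR (ln (nm (y i) / l2 y) - ln (nm (v i) / l2 v)).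
  by rewrite /kalton_peck rmorphB; ring.
rewrite -ln_div ?posrE ?divr_gt0// !nmM nm_ofR.
set t := (_ / _ / _).
have t0 : 0 < t by rewrite !divr_gt0// invr_gt0.
apply: (@le_trans _ _ (nm (y i) * nm (v i) * (t + t^-1))).
  by rewrite ler_wpM2l ?mulr_ge0 ?nm_ge0 ?norm_ln_le.
rewrite le_eqVlt; apply/orP; left; apply/eqP; rewrite /t.
by field; rewrite !gt_eqF.
Qed.

Lemma l2_sum n (x : 'I_n -> I -> K) :
  l2 (fun i => \sum_(j < n) x j i) <= \sum_(j < n) l2 (x j).
Proof.
elim: n x => [|n IH] x.
  rewrite big_ord0 (@eq_l2 _ _ _ _ _ (fun=> 0)) ?l2_0// => i.
  by rewrite big_ord0.
rewrite big_ord_recr /= (@eq_l2 _ _ _ _ _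
  (fun i => \sum_(j < n) x (widen_ord (leqnSn n) j) i + x ord_max i)).
  by apply: le_trans (l2D _ _ _) _; rewrite lerD2r IH.
by move=> i; rewrite big_ord_recr.
Qed.

(* The symmetry estimate above makes the nonlinear map [kalton_peck] additive
   up to a uniformly bounded error, whatever the number of summands. *)
Lemma kalton_peck_sum n (a : 'I_n -> K) (y : 'I_n -> I -> K) :
  l2 (fun i => \sum_(j < n) a j * kalton_peck (y j) i -
               kalton_peck (fun i => \sum_(j < n) a j * y j i) i) <=
  4 * \sum_(j < n) nm (a j) * l2 (y j).
Proof.
set Y := fun i => \sum_(j < n) a j * y j i.
set s := \sum_(j < n) nm (a j) * l2 (y j).
have s0 : 0 <= s by apply: sumr_ge0 => j _; rewrite mulr_ge0 ?nm_ge0 ?l2_ge0.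
have Ys : l2 Y <= s.
  by apply: le_trans (l2_sum _) _; apply: ler_sum => j _; rewrite l2Z.
apply: l2_dual => [|v]; first by rewrite mulr_ge0.
(* The terms [y j i * kalton_peck v i] are linear in [y j], so those inserted for the summands
   cancel the one inserted for [Y]. Two symmetry defects remain, each with constant 2. *)
have -> : \sum_i (\sum_(j < n) a j * kalton_peck (y j) i - kalton_peck Y i) * v i =
    \sum_(j < n) a j * (\sum_i (kalton_peck (y j) i * v i - y j i * kalton_peck v i)) -
    \sum_i (kalton_peck Y i * v i - Y i * kalton_peck v i).
  under [in RHS]eq_bigr do rewrite mulr_sumr.
  rewrite exchange_big /= -sumrB; apply: eq_bigr => i _.
  have -> : \sum_(j < n) a j * (kalton_peck (y j) i * v i - y j i * kalton_peck v i) =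
      (\sum_(j < n) a j * kalton_peck (y j) i) * v i - Y i * kalton_peck v i.
    rewrite /Y !mulr_suml -sumrB; apply: eq_bigr => j _.
    by rewrite mulrBr !mulrA.
  by rewrite mulrBl opprB addrA subrK.
apply: le_trans (nmB _ _ _) _.
have h1 := kalton_peck_symmetric Y v.
have h2 : nm (\sum_(j < n) a j *
    (\sum_i (kalton_peck (y j) i * v i - y j i * kalton_peck v i))) <= 2 * s * l2 v.
  apply: le_trans (nm_sum _ _ _ _) _; rewrite /s mulrAC mulr_sumr.
  apply: ler_sum => j _; rewrite nmM.
  apply: (@le_trans _ _ (nm (a j) * (2 * l2 (y j) * l2 v))).
    by rewrite ler_wpM2l ?nm_ge0// kalton_peck_symmetric.
  by rewrite le_eqVlt; apply/orP; left; apply/eqP; ring.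
have h3 : 2 * l2 Y * l2 v <= 2 * s * l2 v by rewrite ler_wpM2r ?l2_ge0// ler_pM2l.
have -> : 4 * s * l2 v = 2 * s * l2 v + 2 * s * l2 v by ring.
by rewrite lerD// (le_trans h1).
Qed.

End KaltonPeck.

(** * The sign cube *)

Section SignCube.
Variable k : nat.
Definition cube : finType := {ffun 'I_k -> bool}.

Definition cube_mul (e f : cube) : cube := [ffun l => e l (+) f l].

Definition sg (C : pzRingType) (e : cube) (i : 'I_k) : C := (-1) ^+ e i.

Lemma cube_mulC e f : cube_mul e f = cube_mul f e.
Proof. by apply/ffunP => l; rewrite !ffunE addbC. Qed.

Lemma cube_mulK e : involutive (cube_mul e).
Proof. by move=> f; apply/ffunP => l; rewrite !ffunE addKb. Qed.

Lemma sg_cube_mul (C : pzRingType) e f i : sg C (cube_mul e f) i = sg C e i * sg C f i.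
Proof. by rewrite /sg ffunE signr_addb. Qed.

Lemma sgK (C : pzRingType) e i : sg C e i * sg C e i = 1.
Proof. by rewrite /sg -signr_addb addbb. Qed.

Lemma rmorph_sg (C D : pzRingType) (f : {rmorphism C -> D}) e i :
  f (sg C e i) = sg D e i.
Proof. exact: rmorph_sign. Qed.

Lemma card_cube : #|cube| = (2 ^ k)%N.
Proof. by rewrite card_ffun card_bool card_ord. Qed.

Lemma sum_cube_prod (C : comNzRingType) (F : 'I_k -> bool -> C) :
  \sum_(e : cube) \prod_l F l (e l) = \prod_l (F l true + F l false).
Proof.
by rewrite -(bigA_distr_bigA F); apply: eq_bigr => l _; rewrite big_bool.
Qed.

(** The product form in which [sum_cube_prod] factors sums over the cube. *)
Lemma sg_prod (C : comNzRingType) (e : cube) i :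
  sg C e i = \prod_l (if l == i then (-1) ^+ e l else 1).
Proof.
by rewrite (bigD1 i)//= eqxx big1 ?mulr1// => l li; rewrite (negPf li).
Qed.

Lemma sg_orthogonal (C : comNzRingType) i j :
  \sum_(e : cube) sg C e i * sg C e j = (i == j)%:R * #|cube|%:R.
Proof.
have [->|ij] := eqVneq i j.
  under eq_bigr do rewrite sgK.
  by rewrite sumr_const mul1r.
rewrite mul0r.
under eq_bigr do rewrite (sg_prod C _ i) (sg_prod C _ j) -big_split.
rewrite (sum_cube_prod (fun l b =>
  (if l == i then (-1) ^+ b else 1) * (if l == j then (-1) ^+ b else 1))).
by rewrite (bigD1 i)//= eqxx (negPf ij) !mulr1 expr1 expr0 addNr mul0r.
Qed.

End SignCube.

(** * A bounded function with large Rademacher coefficients *)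

Section RieszProduct.
Variables (R : realType) (k : nat).
Hypothesis k0 : (0 < k)%N.
Local Notation C := R[i].

Let t : R := (Num.sqrt k%:R)^-1.

Let sqr_t : t ^+ 2 = k%:R^-1.
Proof. by rewrite exprVn sqr_sqrtr. Qed.

Let riesz (e : cube k) : C := \prod_l (1 + 'i%C * t%:C%C * (-1) ^+ e l).

(** A purely imaginary increment gives each factor the squared modulus [1 + t ^+ 2], whatever the
    sign. As [t ^+ 2 = 1 / k], the product stays below [e], whereas factors [1 + t] would grow like
    [e] to the power [sqrt k]. *)
Let normc_sqr_riesz e : (complex.Re (riesz e)) ^+ 2 + (complex.Im (riesz e)) ^+ 2 =
  (1 + t ^+ 2) ^+ k.
Proof.
apply: (@complexI R).
rewrite add_Re2_Im2 normr_prod -prodrXl.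
rewrite (eq_bigr (fun=> ((1 + t ^+ 2)%:C)%C)); last first.
  move=> l _; rewrite -add_Re2_Im2; congr (_%:C)%C.
  by case: (e l); rewrite ?expr1 ?expr0 ?mulrN !mulr1 /=; ring.
by rewrite prodr_const card_ord rmorphXn.
Qed.

Let im_riesz_le e : `|complex.Im (riesz e)| <= expR 1.
Proof.
have h : complex.Im (riesz e) ^+ 2 <= expR 1.
  apply: (@le_trans _ _ ((1 + t ^+ 2) ^+ k)).
    by rewrite -(normc_sqr_riesz e) lerDr sqr_ge0.
  apply: (@le_trans _ _ (expR (t ^+ 2) ^+ k)).
    by rewrite lerXn2r ?nnegrE ?expR_ge0 ?expR_ge1Dx// addr_ge0 ?sqr_ge0.
  by rewrite -expRM_natl sqr_t mulfV// pnatr_eq0 -lt0n.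
have e1 : 1 <= expR 1 :> R by rewrite -expR0 ler_expR.
rewrite -(@ler_pXn2r _ 2)// ?nnegrE ?expR_ge0// real_normK ?num_real//.
by apply: le_trans h _; rewrite expr2 ler_peMl ?expR_ge0.
Qed.

(** The sum factors over the coordinates: the [i]-th factor is [(1 + i t) - (1 - i t)], all others
    are [2]. *)
Let sum_sg_riesz i : \sum_(e : cube k) sg C e i * riesz e =
  'i%C * (2 ^ k)%:R * t%:C%C.
Proof.
under eq_bigr do rewrite (sg_prod C _ i) /riesz -big_split.
rewrite (sum_cube_prod (fun l b => (if l == i then (-1) ^+ b else 1) *
  (1 + 'i%C * t%:C%C * (-1) ^+ b))).
rewrite (bigD1 i)//= eqxx expr1 expr0 !mulr1 mul1r mulrN1 mulN1r opprB.
rewrite (eq_bigr (fun=> 2)); last first.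
  move=> l li; rewrite (negPf li) !mul1r; ring.
rewrite prodr_const cardC1 card_ord -[k in (2 ^ k)%N](prednK k0).
by rewrite expnS natrM natrX; ring.
Qed.

(* The imaginary part of the Riesz product [prod_l (1 + i e_l / sqrt k)] is
   uniformly bounded, and all its first order coefficients are [1 / sqrt k]. *)
Lemma riesz_product : exists h : cube k -> R,
  (forall e, `|h e| <= expR 1) /\
  forall e i, \sum_(f : cube k) sg R f i * h (cube_mul e f) =
    sg R e i * (#|cube k|%:R / Num.sqrt k%:R).
Proof.
exists (fun e => complex.Im (riesz e)); split=> [//|e i].
have im_sum : \sum_(f : cube k) sg R f i * complex.Im (riesz f) =
    (2 ^ k)%:R * t.
  have imM (a : R) (z : C) : complex.Im ((a%:C)%C * z) = a * complex.Im z.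
    by case: z => x y /=; rewrite mul0r addr0.
  have imS : {morph @complex.Im R : x y / x + y} by case=> ? ? [].
  have -> : (2 ^ k)%:R * t = complex.Im ('i%C * (2 ^ k)%:R * t%:C%C).
    have -> : 'i%C * (2 ^ k)%:R * t%:C%C = ((2 ^ k)%:R * t)%:C%C * 'i%C.
      by rewrite rmorphM rmorph_nat; ring.
    by rewrite imM /= mulr1.
  rewrite -(sum_sg_riesz i) (big_morph _ imS (id1 := 0))//.
  by apply: eq_bigr => f _; rewrite -imM (rmorph_sg (real_complex R)).
rewrite card_cube -/t -im_sum mulr_sumr (reindex_inj (inv_inj (cube_mulK e))).
by apply: eq_bigr => f _; rewrite cube_mulK sg_cube_mul mulrA.
Qed.

End RieszProduct.

Section CubeBessel.
Variables (R : realType) (K : numFieldType) (S : scalar_parts R K) (k : nat).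
Local Notation nm := (nm S).
Local Notation ofR := (ofR S).

Lemma nm_sg (e : cube k) i : nm (sg K e i : K) = 1.
Proof. by rewrite -(rmorph_sg (ofR)) nm_ofR /sg normr_sign. Qed.

Lemma sum_sqr_sg (b : 'I_k -> K) :
  \sum_(e : cube k) nm (\sum_i b i * sg K e i) ^+ 2 = #|cube k|%:R * l2 S b ^+ 2.
Proof.
apply: (@ofR_inj _ _ S); rewrite rmorphM rmorph_nat sqr_l2 !rmorph_sum.
under eq_bigr do rewrite -(mul_scalar_conj S).
have cs (f : 'I_k -> K) : scalar_conj (\sum_i f i) = \sum_i scalar_conj (f i).
  rewrite (big_morph _ (scalar_conjD S) (id1 := 0))//.
  by rewrite -(rmorph0 ofR) scalar_conj_ofR.
have csg (e : cube k) i : scalar_conj (sg K e i) = sg K e i :> K.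
  by rewrite -(rmorph_sg ofR) scalar_conj_ofR.
under eq_bigr do rewrite cs mulr_suml.
rewrite exchange_big mulr_sumr; apply: eq_bigr => i _ /=.
under eq_bigr do rewrite mulr_sumr.
rewrite exchange_big (bigD1 i)//= [X in _ + X]big1 ?addr0 => [|j ji].
  under eq_bigr do rewrite scalar_conjM csg mulrACA sgK mulr1.
  by rewrite sumr_const (mul_scalar_conj S) mulr_natl.
under eq_bigr do rewrite scalar_conjM csg mulrACA.
by rewrite -mulr_sumr sg_orthogonal eq_sym (negPf ji) mul0r mulr0.
Qed.

(** The easy half of Khintchine's inequality: the mean is at most the quadratic mean, which
    orthogonality computes. *)
Lemma sum_nm_sg_le (b : 'I_k -> K) :
  \sum_(e : cube k) nm (\sum_i b i * sg K e i) <= #|cube k|%:R * l2 S b.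
Proof.
rewrite -(@ler_pXn2r _ 2)// ?nnegrE ?mulr_ge0 ?l2_ge0 ?sumr_ge0//; last first.
  by move=> e _; exact: nm_ge0.
have := sum_mul_sqr_le (fun=> 1 : R) (fun e : cube k => nm (\sum_i b i * sg K e i)).
under eq_bigr do rewrite mul1r.
rewrite sum_sqr_sg; under [X in _ <= X * _ -> _]eq_bigr do rewrite expr1n.
by rewrite sumr_const mulrA -expr2 -exprMn.
Qed.

End CubeBessel.

(** * Functions on the sign cube as vectors of [E] *)

Section CubeInE.
Variables (R : realType) (K : numFieldType) (S : scalar_parts R K).
Local Notation nm := (nm S).
Local Notation ofR := (ofR S).
Local Notation l2 := (l2 S).
Variables (E : normedModType K) (k : nat) (D : R).
Hypotheses (k0 : (0 < k)%N) (D0 : 0 <= D).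
Variables (g : {linear linf K #|cube k| -> E}).
Variables (p : 'I_#|cube k| -> {linear E -> K^o}).
Hypothesis pg : forall v j, p j (g v) = (v : 'rV[K]_#|cube k|) 0 j.
Hypothesis gD : forall v, nm (g v) <= D * nm v.
Hypothesis p1 : forall j y, nm (p j y) <= nm y.

Let N : R := #|cube k|%:R.
Let sk : R := Num.sqrt k%:R.

Let N0 : 0 < N.
Proof. by rewrite ltr0n card_cube expn_gt0. Qed.

Let sk0 : 0 < sk.
Proof. by rewrite sqrtr_gt0 ltr0n. Qed.

Definition cube_vec (phi : cube k -> K) : linf K #|cube k| :=
  \row_j phi (enum_val j).

Lemma p_cube_vec phi e : p (enum_rank e) (g (cube_vec phi)) = phi e.
Proof. by rewrite pg mxE enum_rankK. Qed.

Lemma nm_cube_vec phi c : 0 <= c -> (forall e, nm (phi e) <= c) ->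
  nm (g (cube_vec phi)) <= D * c.
Proof.
move=> c0 h; apply: le_trans (gD _) _; rewrite ler_wpM2l// nm_linf_le// => j.
by rewrite mxE.
Qed.

Definition rademacher_coef (y : E) (i : 'I_k) : K :=
  ofR N^-1 * \sum_(e : cube k) sg K e i * p (enum_rank e) y.

Lemma rademacher_coef_linear a x y i :
  rademacher_coef (a *: x + y) i = a * rademacher_coef x i + rademacher_coef y i.
Proof.
rewrite /rademacher_coef mulrCA -mulrDr; congr (_ * _).
rewrite mulr_sumr -big_split.
apply: eq_bigr => e _ /=.
by rewrite linearP /= mulrDr mulrCA.
Qed.

Lemma rademacher_coef_sum n (a : 'I_n -> K) (y : 'I_n -> E) i :
  rademacher_coef (\sum_(j < n) a j *: y j) i =
  \sum_(j < n) a j * rademacher_coef (y j) i.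
Proof.
have lin : linear (rademacher_coef ^~ i : E -> K^o).
  by move=> a' x z; exact: rademacher_coef_linear.
rewrite -[LHS]/(pack_linear lin _) linear_sum; apply: eq_bigr => j _.
by rewrite linearZ.
Qed.

(** Dual to [sum_nm_sg_le]: pairing with [v] averages the values of [y] on the cube, each at most
    [nm y], against the Rademacher sum of [v]. *)
Lemma l2_rademacher_coef y : l2 (rademacher_coef y) <= nm y.
Proof.
apply: l2_dual => [|v]; first exact: nm_ge0.
have -> : \sum_i rademacher_coef y i * v i =
    ofR N^-1 * \sum_(e : cube k) p (enum_rank e) y * \sum_i v i * sg K e i.
  under [in RHS]eq_bigr do rewrite mulr_sumr.
  rewrite exchange_big mulr_sumr; apply: eq_bigr => i _ /=.
  rewrite /rademacher_coef -mulrA mulr_suml; congr (_ * _).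
  by apply: eq_bigr => e _; ring.
rewrite nmM nm_ofR gtr0_norm ?invr_gt0// ler_pdivrMl//.
apply: le_trans (nm_sum _ _ _ _) _.
apply: (@le_trans _ _ (\sum_(e : cube k) nm y * nm (\sum_i v i * sg K e i))).
  by apply: ler_sum => e _; rewrite nmM ler_wpM2r ?nm_ge0.
by rewrite -mulr_sumr mulrCA ler_wpM2l ?nm_ge0// sum_nm_sg_le.
Qed.

Definition rademacher i : E := g (cube_vec (fun e => sg K e i)).

Lemma nm_rademacher i : nm (rademacher i) <= D.
Proof.
by rewrite -[leRHS]mulr1; apply: nm_cube_vec => // e; rewrite nm_sg.
Qed.

Lemma rademacher_coefE i j : rademacher_coef (rademacher i) j = (j == i)%:R.
Proof.
rewrite /rademacher_coef; under eq_bigr do rewrite p_cube_vec.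
rewrite sg_orthogonal -(rmorph_nat ofR #|cube k|) mulrCA -rmorphM.
by rewrite (mulVf (lt0r_neq0 N0)) rmorph1 mulr1.
Qed.

Variable h : cube k -> R.
Hypothesis h_le : forall e, `|h e| <= expR 1.
Hypothesis hE : forall e i, \sum_(f : cube k) sg R f i * h (cube_mul e f) =
    sg R e i * (N / sk).

Definition flat e : E := g (cube_vec (fun f => ofR (h (cube_mul e f)))).

Lemma nm_flat e : nm (flat e) <= D * expR 1.
Proof.
by apply: nm_cube_vec => [|f]; rewrite ?expR_ge0// nm_ofR h_le.
Qed.

Let hEK e i : \sum_(f : cube k) sg K f i * ofR (h (cube_mul e f)) =
  sg K e i * ofR (N / sk).
Proof.
rewrite -(rmorph_sg ofR) -rmorphM -hE rmorph_sum; apply: eq_bigr => f _.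
by rewrite rmorphM rmorph_sg.
Qed.

Lemma rademacher_coef_flat e i : rademacher_coef (flat e) i = ofR sk^-1 * sg K e i.
Proof.
rewrite /rademacher_coef; under eq_bigr do rewrite p_cube_vec.
rewrite hEK mulrCA -rmorphM mulrA mulVf ?gt_eqF// mul1r mulrC//.
Qed.

(** The identity [hE] behind [rademacher_coef_flat], read in the other variable of
    [cube_mul e f]. *)
Lemma sum_flat i :
  ofR N^-1 *: \sum_(e : cube k) sg K e i *: flat e = ofR sk^-1 *: rademacher i.
Proof.
have gZ a v : a *: g v = g (a *: v) by rewrite linearZ.
rewrite /flat /rademacher; under eq_bigr do rewrite gZ.
rewrite -linear_sum !gZ; congr (g _); apply/rowP => j.
rewrite !mxE summxE; under eq_bigr do rewrite !mxE cube_mulC.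
by rewrite hEK mulrCA -rmorphM mulrA mulVf ?gt_eqF// mul1r mulrC.
Qed.

Lemma kalton_peck_rademacher i j : kalton_peck S (fun l : 'I_k => (l == i)%:R) j = 0.
Proof.
have l21 : l2 (fun l : 'I_k => (l == i)%:R) = 1.
  rewrite /l2 (bigD1 i)//= eqxx nm1 expr1n big1 ?addr0 ?sqrtr1// => l li.
  by rewrite (negPf li) nm0 expr0n.
rewrite /kalton_peck l21 divr1; case: eqP => _; last by rewrite mulr0.
by rewrite nm1 ln1 rmorph0 mul0r.
Qed.

Lemma kalton_peck_flat (e : cube k) i :
  kalton_peck S (fun l => ofR sk^-1 * sg K e l) i =
  - ofR (ln sk / sk) * sg K e i.
Proof.
have nmE l : nm (ofR sk^-1 * sg K e l) = sk^-1.
  by rewrite nmM nm_ofR nm_sg mulr1 gtr0_norm ?invr_gt0.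
have l21 : l2 (fun l => ofR sk^-1 * sg K e l) = 1.
  rewrite /l2; under eq_bigr do rewrite nmE.
  rewrite sumr_const card_ord -mulr_natl exprVn sqr_sqrtr ?ler0n//.
  by rewrite divff ?sqrtr1// pnatr_eq0 -lt0n.
rewrite /kalton_peck l21 nmE divr1 lnV ?posrE//.
by rewrite mulrA -rmorphM mulNr rmorphN.
Qed.

End CubeInE.

(** * Vectors of the kernel *)

Section Lifting.
Variables (R : realType) (K : numFieldType) (S : scalar_parts R K).
Local Notation nm := (nm S).
Local Notation ofR := (ofR S).
Local Notation l2 := (l2 S).

(* On each [l1]-subspace [kalton_peck \o pi \o Q] is replaced by its linear
   interpolation at the images of the unit vectors. *)
Lemma linear_kalton_peck (F : completeNormedModType K) (E : normedModType K)
    (Q : {linear F -> E}) (M : R) (I : finType) (pi : E -> I -> K) :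
  script_L1_space F -> 0 <= M -> (forall x, nm (Q x) <= M * nm x) ->
  (forall n (a : 'I_n -> K) (y : 'I_n -> E) i,
    pi (\sum_(j < n) a j *: y j) i = \sum_(j < n) a j * pi (y j) i) ->
  (forall y, l2 (pi y) <= nm y) ->
  forall C, (forall s : seq F,
    exists (n : nat) (e : 'I_n -> F) (a : F -> 'I_n -> K),
    [/\ forall c x y i, x \in s -> y \in s -> c *: x + y \in s ->
          a (c *: x + y) i = c * a x i + a y i,
        forall x, x \in s -> x = \sum_(i < n) a x i *: e i &
        forall x, x \in s -> \sum_(i < n) nm (a x i) * nm (e i) <= C * nm x]) ->
  exists w : F -> I -> K,
    (forall a x y i, w (a *: x + y) i = a * w x i + w y i) /\
    (forall x, l2 (fun i => w x i - kalton_peck S (pi (Q x)) i) <=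
      4 * (M * C) * nm x).
Proof.
move=> hF M0 QM pi_sum pi_le C FC.
apply: linear_approximation_compactness => s.
have [n [e [a [alin xE aC]]]] := FC s.
exists (fun x i => \sum_(j < n) a x j * kalton_peck S (pi (Q (e j))) i).
split=> [c x y i xs ys xys|x xs].
  rewrite mulr_sumr -big_split; apply: eq_bigr => j _ /=.
  by rewrite alin//; ring.
have piQ : pi (Q x) = fun i => \sum_(j < n) a x j * pi (Q (e j)) i.
  apply/funext => i; rewrite {1}(xE x xs) linear_sum.
  by under eq_bigr do rewrite linearZ; rewrite pi_sum.
rewrite piQ; apply: le_trans (kalton_peck_sum _ _ _) _.
rewrite -mulrA ler_pM2l// -mulrA.
apply: (@le_trans _ _ (M * \sum_(j < n) nm (a x j) * nm (e j))).
  rewrite mulr_sumr; apply: ler_sum => j _.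
  rewrite mulrCA ler_wpM2l ?nm_ge0//.
  exact: le_trans (pi_le _) (QM _).
by rewrite ler_wpM2l// aC.
Qed.

End Lifting.

Section KernelVectors.
Variables (R : realType) (K : numFieldType) (S : scalar_parts R K).
Local Notation nm := (nm S).
Local Notation ofR := (ofR S).
Local Notation l2 := (l2 S).
Variables (F E : normedModType K) (Q : {linear F -> E}).
Variables (k : nat) (D lam C1 : R).
Hypotheses (k0 : (0 < k)%N) (D0 : 0 <= D) (lam0 : 0 <= lam) (C10 : 0 <= C1).
Hypothesis Qlift : forall y, exists2 x, Q x = y & nm x <= lam * nm y.
Variables (r : 'I_k -> E) (fl : cube k -> E).
Let N : R := #|cube k|%:R.
Let sk : R := Num.sqrt k%:R.
Hypothesis r_le : forall i, nm (r i) <= D.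
Hypothesis fl_le : forall e, nm (fl e) <= D * expR 1.
Hypothesis fl_sum : forall i,
  ofR N^-1 *: \sum_(e : cube k) sg K e i *: fl e = ofR sk^-1 *: r i.
Variables (w : F -> 'I_k -> K) (Om : E -> 'I_k -> K).
Hypothesis w_lin : forall a x y i, w (a *: x + y) i = a * w x i + w y i.
Hypothesis wOm : forall x, l2 (fun i => w x i - Om (Q x) i) <= C1 * nm x.
Hypothesis Om_r : forall i, Om (r i) i = 0.
Hypothesis Om_fl : forall e i, Om (fl e) i = - ofR (ln sk / sk) * sg K e i.

Let N0 : 0 < N.
Proof. by rewrite ltr0n card_cube expn_gt0. Qed.

Let sk0 : 0 < sk.
Proof. by rewrite sqrtr_gt0 ltr0n. Qed.

Let sk2 : sk * sk = k%:R.
Proof. by rewrite -expr2 sqr_sqrtr. Qed.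

Let w0 i : w 0 i = 0.
Proof. by have := w_lin (-1) 0 0 i; rewrite scaler0 addr0 mulN1r addNr. Qed.

Let wZ a x i : w (a *: x) i = a * w x i.
Proof. by rewrite -[a *: x]addr0 w_lin w0 addr0. Qed.

Let wD x y i : w (x + y) i = w x i + w y i.
Proof. by rewrite -[x]scale1r w_lin !scale1r mul1r. Qed.

Let w_sum (I : finType) (x : I -> F) i : w (\sum_j x j) i = \sum_j w (x j) i.
Proof. by apply: (big_morph (fun x => w x i)) => // x' y; exact: wD. Qed.

Let l2_one : l2 (fun _ : 'I_k => (1 : K)) = sk.
Proof.
by rewrite /l2; under eq_bigr do rewrite nm1 expr1n; rewrite sumr_const card_ord.
Qed.

Let sum_nm_le (b : 'I_k -> K) : \sum_i nm (b i) <= sk * l2 b.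
Proof.
have := sum_nmM_le S b (fun _ : 'I_k => (1 : K)).
by under eq_bigr do rewrite nm1 mulr1; rewrite l2_one mulrC.
Qed.

(** The last bound goes through the trace [\sum_i w (z i) i]. The lifts of the flat vectors
    contribute [- sk * ln sk] up to an error of order [sk], and those of the vectors [r i], divided
    by [sk], contribute only order [sk]. Cauchy-Schwarz bounds the trace by [sk] times the square
    root on the right. *)
Lemma kernel_vectors : exists z : 'I_k -> F,
  [/\ forall i, Q (z i) = 0,
      forall b : 'I_k -> K,
        nm (\sum_i b i *: z i) <= lam * D * (expR 1 + 1) * l2 b &
      ln sk <= Num.sqrt (\sum_i l2 (w (z i)) ^+ 2) +
        C1 * (lam * D * (expR 1 + 1))].
Proof.
have lift y : exists x, Q x = y /\ nm x <= lam * nm y.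
  by have [x ? ?] := Qlift y; exists x.
have [L LP] := choice lift.
pose rl i := L (r i); pose hl e := L (fl e).
have rl_le i : nm (rl i) <= lam * D.
  by apply: le_trans (LP _).2 _; rewrite ler_wpM2l.
have hl_le e : nm (hl e) <= lam * D * expR 1.
  by apply: le_trans (LP _).2 _; rewrite -mulrA ler_wpM2l.
have lD0 : 0 <= lam * D by rewrite mulr_ge0.
pose z i := ofR N^-1 *: \sum_(e : cube k) sg K e i *: hl e - ofR sk^-1 *: rl i.
exists z; split.
- have QZ a x : Q (a *: x) = a *: Q x by rewrite linearZ.
  move=> i; rewrite linearB !QZ linear_sum.
  under eq_bigr do rewrite QZ (LP _).1.
  by rewrite (LP _).1 fl_sum subrr.
- move=> b.
  (* After this exchange the first sum is bounded by [sum_nm_sg_le], and the second by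
     [\sum_i nm (b i) <= k * (lam * D)]-free Cauchy-Schwarz, whose factor [sk] is absorbed by
     [sk^-1]. *)
  have -> : \sum_i b i *: z i =
      ofR N^-1 *: (\sum_(e : cube k) (\sum_i b i * sg K e i) *: hl e) -
      ofR sk^-1 *: \sum_i b i *: rl i.
    under [in RHS]eq_bigr do rewrite scaler_suml.
    rewrite exchange_big !scaler_sumr -sumrB; apply: eq_bigr => i _ /=.
    rewrite /z scalerBr !scalerA ![b i * _]mulrC -!scalerA; congr (_ *: _ - _).
    rewrite scaler_sumr; apply: eq_bigr => e _.
    by rewrite scalerA.
  apply: le_trans (nmB _ _ _) _.
  have -> : lam * D * (expR 1 + 1) * l2 b = lam * D * expR 1 * l2 b + lam * D * l2 b.
    by ring.
  rewrite !nmZ !nm_ofR !gtr0_norm ?invr_gt0//; apply: lerD.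
    rewrite ler_pdivrMl//; apply: le_trans (nm_sum _ _ _ _) _.
    apply: (@le_trans _ _ (\sum_(e : cube k) nm (\sum_i b i * sg K e i) * (lam * D * expR 1))).
      by apply: ler_sum => e _; rewrite nmZ ler_wpM2l ?nm_ge0.
    rewrite -mulr_suml [leRHS]mulrCA [leRHS]mulrC ler_wpM2r ?mulr_ge0 ?expR_ge0//.
    exact: sum_nm_sg_le.
  rewrite ler_pdivrMl//; apply: le_trans (nm_sum _ _ _ _) _.
  apply: (@le_trans _ _ (\sum_i nm (b i) * (lam * D))).
    by apply: ler_sum => i _; rewrite nmZ ler_wpM2l ?nm_ge0.
  rewrite -mulr_suml [leRHS]mulrCA [leRHS]mulrC ler_wpM2r//.
(* Paired with the signs of [e], the vector [Om (fl e)] gives [- k * (ln sk / sk) = - sk * ln sk].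
   The error of [w] is paired with a sign vector of norm [sk]. *)
- have flat_part e : nm (\sum_i sg K e i * w (hl e) i + ofR (sk * ln sk)) <=
      sk * (C1 * (lam * D * expR 1)).
    have -> : \sum_i sg K e i * w (hl e) i + ofR (sk * ln sk) =
        \sum_i sg K e i * (w (hl e) i - Om (Q (hl e)) i).
      under [RHS]eq_bigr do rewrite mulrBr (LP _).1 Om_fl mulrCA sgK mulr1.
      rewrite sumrB sumr_const card_ord -mulr_natr -(rmorph_nat ofR) -sk2.
      rewrite mulNr opprK -rmorphM; congr (_ + ofR _).
      by field; rewrite gt_eqF.
    apply: le_trans (nm_sumM_le _ _ _) _.
    have -> : l2 (fun i => sg K e i) = sk.
      rewrite -l2_one /l2; congr Num.sqrt.
      by apply: eq_bigr => i _; rewrite nm_sg nm1.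
    rewrite ler_wpM2l ?(ltW sk0)//; apply: le_trans (wOm _) _.
    by rewrite ler_wpM2l.
  have r_part i : nm (w (rl i) i) <= C1 * (lam * D).
    have -> : w (rl i) i = w (rl i) i - Om (Q (rl i)) i.
      by rewrite (LP _).1 Om_r subr0.
    apply: le_trans (nm_le_l2 S (fun i0 => w (rl i) i0 - Om (Q (rl i)) i0) i) _.
    by apply: le_trans (wOm _) _; rewrite ler_wpM2l.
  have wz i : w (z i) i = ofR N^-1 * (\sum_(e : cube k) sg K e i * w (hl e) i) -
      ofR sk^-1 * w (rl i) i.
    rewrite /z wD -scaleNr !wZ w_sum mulNr; congr (_ * _ - _).
    by apply: eq_bigr => e _; rewrite wZ.
  (* [sk * ln sk] is added inside the average over [e], so that each term is small by
     [flat_part]. *)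
  have sumE : ofR (sk * ln sk) = - (\sum_i w (z i) i) +
      (ofR N^-1 * \sum_(e : cube k) (\sum_i sg K e i * w (hl e) i + ofR (sk * ln sk))
       - ofR sk^-1 * \sum_i w (rl i) i).
    rewrite big_split /= sumr_const -mulr_natl -(rmorph_nat ofR) mulrDr mulrA -rmorphM.
    rewrite (mulVf (lt0r_neq0 N0)) rmorph1 mul1r.
    under eq_bigr do rewrite wz.
    rewrite sumrB -!mulr_sumr exchange_big /=.
    set x := ofR N^-1 * _; set y := ofR sk^-1 * _.
    by ring.
  have le1 : sk * ln sk <= nm (\sum_i w (z i) i) + sk * (C1 * (lam * D * (expR 1 + 1))).
    apply: le_trans (ler_norm _) _; rewrite -(nm_ofR S) sumE.
    apply: le_trans (nmD _ _ _) _; rewrite nmN lerD2l.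
    apply: le_trans (nmB _ _ _) _.
    have -> : sk * (C1 * (lam * D * (expR 1 + 1))) =
        sk * (C1 * (lam * D * expR 1)) + sk * (C1 * (lam * D)) by ring.
    rewrite !nmM !nm_ofR !gtr0_norm ?invr_gt0//; apply: lerD.
      rewrite ler_pdivrMl//; apply: le_trans (nm_sum _ _ _ _) _.
      apply: (@le_trans _ _ (\sum_(e : cube k) sk * (C1 * (lam * D * expR 1)))).
        by apply: ler_sum.
      by rewrite sumr_const -mulr_natl.
    rewrite ler_pdivrMl// [leRHS]mulrA sk2; apply: le_trans (nm_sum _ _ _ _) _.
    apply: (@le_trans _ _ (\sum_(i < k) C1 * (lam * D))); first exact: ler_sum.
    by rewrite sumr_const card_ord mulr_natl.
  have le2 : nm (\sum_i w (z i) i) <= sk * Num.sqrt (\sum_i l2 (w (z i)) ^+ 2).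
    apply: le_trans (nm_sum _ _ _ _) _; apply: le_trans (sum_nm_le _) _.
    rewrite ler_wpM2l ?(ltW sk0)// ler_wsqrtr//; apply: ler_sum => i _.
    by rewrite ler_pXn2r ?nnegrE ?nm_ge0 ?l2_ge0// nm_le_l2.
  rewrite -(ler_pM2l sk0) mulrDr; apply: le_trans le1 _.
  by rewrite lerD2r.
Qed.

End KernelVectors.

(** * Finite rank blocks with unbounded 2-summing constants *)

Section Blocks.
Variables (R : realType) (K : numFieldType) (S : scalar_parts R K).
Local Notation nm := (nm S).
Local Notation ofR := (ofR S).
Local Notation l2 := (l2 S).
Variables (F E : completeNormedModType K) (Q : {linear F -> E}).
Hypotheses (hF : script_L1_space F) (hE : contains_linf_uniformly E).
Hypothesis Qbounded : bounded_op Q.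
Hypothesis Qsurj : forall y : E, exists x : F, Q x = y.

(** Each [w] has finite rank, so alone it is 2-summing on the kernel; what matters is that [C1] and
    [C2] do not depend on [X], which forces arbitrarily large 2-summing constants at bounded
    norm. *)
Lemma kernel_blocks : exists C1 C2 : R, [/\ 0 <= C1, 0 <= C2 & forall X : R,
  exists (k : nat) (w : F -> 'I_k -> K) (z : 'I_k -> F),
  [/\ forall a x y i, w (a *: x + y) i = a * w x i + w y i,
      forall x, Q x = 0 -> l2 (w x) <= C1 * nm x,
      forall i, Q (z i) = 0,
      forall b : 'I_k -> K, nm (\sum_i b i *: z i) <= C2 * l2 b &
      X <= Num.sqrt (\sum_i l2 (w (z i)) ^+ 2)]].
Proof.
have [M M0 QM] := bounded_opP S Qbounded.
have [lam lam0 Qlift] := open_mapping QM Qsurj.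
have [D D0 ED] := contains_linf_uniformlyP S hE.
have [C C0 FC] := script_L1_local S hF.
exists (4 * (M * C)), (lam * D * (expR 1 + 1)).
have C10 : 0 <= 4 * (M * C) by rewrite !mulr_ge0.
split=> //; first by rewrite !mulr_ge0// addr_ge0 ?expR_ge0.
move=> X.
(* The additive loss in [kernel_vectors] does not depend on [k], so it is paid for in advance by the
   choice of [k]. *)
pose B := X + 4 * (M * C) * (lam * D * (expR 1 + 1)).
have [k [k0 lnk]] : exists k, (0 < k)%N /\ B <= ln (Num.sqrt k%:R).
  exists (Num.trunc (expR B ^+ 2)).+1; split=> //.
  rewrite -[leLHS]expRK ler_ln ?posrE ?expR_gt0 ?sqrtr_gt0 ?ltr0n//.
  rewrite -[leLHS]ger0_norm ?expR_ge0// -sqrtr_sqr ler_wsqrtr//.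
  by apply/ltW/truncnS_gt.
have card_gt0 : (1 <= #|cube k|)%N by rewrite card_cube expn_gt0.
have [g [p [pg gD p1]]] := ED _ card_gt0.
have [h [h_le hE']] := riesz_product R k0.
pose pi := rademacher_coef S p.
have [w [w_lin wP]] := linear_kalton_peck hF M0 QM
  (rademacher_coef_sum S p) (l2_rademacher_coef p1) FC.
have Om_r i : kalton_peck S (pi (rademacher g i)) i = 0.
  have -> : pi (rademacher g i) = fun l => (l == i)%:R.
    by apply/funext => l; exact: (rademacher_coefE S pg).
  exact: kalton_peck_rademacher.
have Om_fl e i : kalton_peck S (pi (flat S g h e)) i =
    - ofR (ln (Num.sqrt k%:R) / Num.sqrt k%:R) * sg K e i.
  have -> : pi (flat S g h e) = fun l => ofR (Num.sqrt k%:R)^-1 * sg K e l.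
    by apply/funext => l; exact: (rademacher_coef_flat S pg hE').
  exact: kalton_peck_flat.
have [z [Qz z_le zX]] := kernel_vectors
  (Om := fun y => kalton_peck S (pi y)) k0 D0 lam0 C10 Qlift
  (nm_rademacher D0 gD) (nm_flat D0 gD h_le) (sum_flat S g hE') w_lin wP Om_r Om_fl.
exists k, w, z; split=> // [x Qx|].
  (* [kalton_peck] vanishes at [0], so on the kernel the approximation bound is a bound for [w]
     itself. *)
  have -> : w x = fun i => w x i - kalton_peck S (pi (Q x)) i.
    apply/funext => i; rewrite kalton_peck0 ?subr0// Qx.
    apply/eqP; rewrite eq_le l2_ge0 andbT.
    by apply: le_trans (l2_rademacher_coef p1 _) _; rewrite nm0.
  exact: wP.
by rewrite -(lerD2r (4 * (M * C) * (lam * D * (expR 1 + 1)))) (le_trans lnk).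
Qed.

End Blocks.

Lemma ler_sum_widen (R : realType) (f : nat -> R) (k N : nat) :
  (forall i, 0 <= f i) -> (forall i, (k <= i)%N -> f i = 0) ->
  \sum_(i < N) f i <= \sum_(i < k) f i.
Proof.
move=> f0 fk; rewrite (big_ord_widen _ _ (leq_maxl N k)).
rewrite (big_ord_widen _ _ (leq_maxr N k)) [leLHS]big_mkcond [leRHS]big_mkcond.
apply: ler_sum => i _; have [ik|/fk->] := ltnP i k; last by case: ifP.
by case: ifP.
Qed.

Lemma sum_expr_quarter_le (R : realType) N :
  \sum_(n < N) (4^-1 : R) ^+ n <= 2 - 2 * 4^-1 ^+ N.
Proof.
elim: N => [|N IH]; first by rewrite big_ord0 expr0 mulr1 subrr.
have q0 : 0 < (4^-1 : R) ^+ N by rewrite exprn_gt0// invr_gt0.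
by rewrite big_ord_recr /= exprS; lra.
Qed.

(** * The weighted sum of the blocks *)

Section DirectSum.
Variables (R : realType) (K : numFieldType) (S : scalar_parts R K).
Local Notation nm := (nm S).
Local Notation ofR := (ofR S).
Local Notation l2 := (l2 S).
Variables (Z : normedModType K) (C1 C2 : R).
Hypotheses (C10 : 0 <= C1) (C20 : 0 <= C2).
Hypothesis blocks : forall X : R,
  exists (k : nat) (w : Z -> 'I_k -> K) (z : 'I_k -> Z),
  [/\ forall a x y i, w (a *: x + y) i = a * w x i + w y i,
      forall x, l2 (w x) <= C1 * nm x,
      forall b : 'I_k -> K, nm (\sum_i b i *: z i) <= C2 * l2 b &
      X <= Num.sqrt (\sum_i l2 (w (z i)) ^+ 2)].

Let block := {k : nat & ((Z -> 'I_k -> K) * ('I_k -> Z))%type}.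

(** The threshold [4 ^+ n] is matched to the weight [2^-1 ^+ n] of block [n]: the squared weights
    are summable, yet [4^-1 ^+ n * (4 ^+ n) ^+ 2 = 4 ^+ n] still tends to infinity. *)
Let good (n : nat) (B : block) := let w := (tagged B).1 in let z := (tagged B).2 in
  [/\ forall a x y i, w (a *: x + y) i = a * w x i + w y i,
      forall x, l2 (w x) <= C1 * nm x,
      forall b : 'I_(tag B) -> K, nm (\sum_i b i *: z i) <= C2 * l2 b &
      4 ^+ n <= Num.sqrt (\sum_i l2 (w (z i)) ^+ 2)].

Let good_ex n : exists B, good n B.
Proof.
by have [k [w [z h]]] := blocks (4 ^+ n); exists (existT _ k (w, z)).
Qed.

Let B n : block := sval (cid (good_ex n)).
Let k n := tag (B n).
Let w n : Z -> 'I_(k n) -> K := (tagged (B n)).1.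
Let z n : 'I_(k n) -> Z := (tagged (B n)).2.
Arguments w : clear implicits.
Arguments z : clear implicits.

Let BP n : good n (B n).
Proof. exact: svalP (cid (good_ex n)). Qed.

(** Padding by zeros turns the block into a row indexed by [nat]. *)
Let w0 n x j : K := 
  if (insub j : option 'I_(k n)) is Some i then w n x i else 0.

Let w0E n x (i : 'I_(k n)) : w0 n x i = w n x i.
Proof. by rewrite /w0 valK. Qed.

Let w0_out n x j : (k n <= j)%N -> w0 n x j = 0.
Proof. by move=> kj; rewrite /w0 insubF// ltnNge kj. Qed.

Let w0_linear n a x y j : w0 n (a *: x + y) j = a * w0 n x j + w0 n y j.
Proof.
have [jk|kj] := ltnP j (k n); last by rewrite !w0_out// mulr0 addr0.
rewrite -[j]/(val (Ordinal jk)) !w0E; have [h _ _ _] := BP n; exact: h.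
Qed.

Let array_of (x : Z) : nat * nat -> K^o :=
  fun p => ofR (2^-1 ^+ p.1) * w0 p.1 x p.2.

Let nm_array_of x n j : nm (array_of x (n, j)) ^+ 2 = 4^-1 ^+ n * nm (w0 n x j) ^+ 2.
Proof.
rewrite nmM nm_ofR ger0_norm ?exprn_ge0 ?invr_ge0// exprMn.
by rewrite exprAC; congr (_ ^+ n * _); rewrite exprVn; congr (_^-1); ring.
Qed.

Let sum_w0_le n x N : \sum_(j < N) nm (w0 n x j) ^+ 2 <= (C1 * nm x) ^+ 2.
Proof.
apply: (@le_trans _ _ (\sum_(j < k n) nm (w0 n x j) ^+ 2)).
  apply: (@ler_sum_widen _ (fun j => nm (w0 n x j) ^+ 2)) => i; first exact: sqr_ge0.
  by move=> ki; rewrite w0_out// nm0 expr0n.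
under eq_bigr do rewrite w0E.
rewrite -sqr_l2 ler_pXn2r ?nnegrE ?l2_ge0 ?mulr_ge0 ?nm_ge0//.
by have [_ h _ _] := BP n; exact: h.
Qed.

Let corner_array_of x N : corner S N (array_of x) <= 2 * C1 * nm x.
Proof.
rewrite -(@ler_pXn2r _ 2)// ?nnegrE ?corner_ge0 ?mulr_ge0 ?nm_ge0//.
rewrite sqr_corner; under eq_bigr do under eq_bigr do rewrite nm_array_of.
apply: (@le_trans _ _ (\sum_(n < N) 4^-1 ^+ n * (C1 * nm x) ^+ 2)).
  by apply: ler_sum => n _; rewrite -mulr_sumr ler_wpM2l ?exprn_ge0 ?invr_ge0//.
rewrite -mulr_suml.
have -> : (2 * C1 * nm x) ^+ 2 = 4 * (C1 * nm x) ^+ 2 by ring.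
rewrite ler_wpM2r ?sqr_ge0//; apply: le_trans (sum_expr_quarter_le R N) _.
have q0 : 0 < (4^-1 : R) ^+ N by rewrite exprn_gt0// invr_gt0.
lra.
Qed.

Let array_of_summable x : array_of x \in square_summable S.
Proof. by apply/asboolP; exists (2 * C1 * nm x) => N; exact: corner_array_of. Qed.

Let u (x : Z) : hilbert S := Hilbert (array_of_summable x).

Let u_linear : linear u.
Proof.
move=> a x y; apply: val_inj; apply/funext => -[n j] /=.
rewrite [RHS]/(_ *: _ + _) /array_of /= w0_linear mulrDr; congr (_ + _).
by rewrite mulrCA.
Qed.

Lemma direct_sum_operator : exists u : {linear Z -> hilbert S},
  bounded_op u /\ ~ two_summing u.
Proof.
exists (pack_linear u_linear); split.
  apply: (@bounded_opI _ _ S _ _ _ (2 * C1)) => x.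
  by apply: nm_hilbert_le => N; exact: corner_array_of.
move=> [C C0 uC].
(* [c] is the bound that 2-summability with constant [C] would give on the vectors of every
   block. *)
pose c := (re S C * C2) ^+ 2; pose n := (Num.trunc c).+1.
have cn : c < 4 ^+ n.
  apply: lt_le_trans (truncnS_gt c) _; rewrite -/n -natrX ler_nat.
  by apply: ltnW; apply: ltn_expl.
have [_ _ zb zn] := BP n.
have lhs : 4 ^+ n <= \sum_(i < k n) nm (u (z n i)) ^+ 2.
  (* A corner large enough to contain row [n] and all the columns of block [n]. *)
  have N0 : (n < maxn n.+1 (k n))%N by rewrite leq_max ltnSn.
  have kN : (k n <= maxn n.+1 (k n))%N by rewrite leq_maxr.
  apply: (@le_trans _ _ (\sum_(i < k n) 4^-1 ^+ n * l2 (w n (z n i)) ^+ 2)).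
    rewrite -mulr_sumr exprVn ler_pdivlMl ?exprn_gt0//.
    move: zn; rewrite -(@ler_pXn2r _ 2)// ?nnegrE ?exprn_ge0 ?sqrtr_ge0//.
    rewrite sqr_sqrtr; last by apply: sumr_ge0 => i _; exact: sqr_ge0.
    by rewrite expr2.
  apply: ler_sum => i _.
  apply: (@le_trans _ _ (corner S (maxn n.+1 (k n)) (array_of (z n i)) ^+ 2)); last first.
    by rewrite ler_pXn2r ?nnegrE ?corner_ge0 ?nm_ge0//; exact: (corner_le_nm _ (u _)).
  rewrite sqr_corner (bigD1 (Ordinal N0))//=.
  apply: (@le_trans _ _ (\sum_(j < maxn n.+1 (k n)) nm (array_of (z n i) (n, val j)) ^+ 2)).
    under [leRHS]eq_bigr do rewrite nm_array_of.
    rewrite -mulr_sumr ler_wpM2l ?exprn_ge0 ?invr_ge0// sqr_l2.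
    rewrite (eq_bigr (fun j : 'I_(k n) => nm (w0 n (z n i) j) ^+ 2)); last first.
      by move=> j _; rewrite w0E.
    rewrite (big_ord_widen _ (fun j => nm (w0 n (z n i) j) ^+ 2) kN) big_mkcond.
    by apply: ler_sum => j _; case: ifP => // _; exact: sqr_ge0.
  rewrite lerDl sumr_ge0// => m _; apply: sumr_ge0 => j _; exact: sqr_ge0.
have := uC (k n) (z n).
set s := supremum _ _.
(* By [l2_dual], the bound on combinations of the [z n i] controls their weak 2-summing norm. *)
have s_le : s <= ofR (C2 ^+ 2).
  apply: supremum_le; first by rewrite ofR_ge0 sqr_ge0.
  move=> _ [f [bf f1] <-].
  have fle x : nm (f x) <= nm x.
    apply: le_trans (le_opnorm S x bf) _; rewrite ler_piMl ?nm_ge0//.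
    by rewrite -(ler_ofR S) -(ge0_ofR S (opnorm_ge0 S bf)) rmorph1.
  under eq_bigr do rewrite -(ofR_nm S) -rmorphXn.
  rewrite -rmorph_sum ler_ofR -(sqr_l2 S (fun i => f (z n i) : K)).
  rewrite ler_pXn2r ?nnegrE ?l2_ge0//; apply: l2_dual => // b.
  have -> : \sum_i (f (z n i) : K) * b i = f (\sum_i b i *: z n i).
    by rewrite linear_sum; apply: eq_bigr => i _; rewrite linearZ mulrC.
  exact: le_trans (fle _) (zb _).
under eq_bigr do rewrite -(ofR_nm S) -rmorphXn.
rewrite -rmorph_sum => h.
have : ofR (\sum_(i < k n) nm (u (z n i)) ^+ 2) <= ofR c.
  apply: le_trans h _; rewrite /c exprMn rmorphM rmorphXn /= -(ge0_ofR S C0).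
  by rewrite ler_wpM2l ?exprn_ge0.
rewrite ler_ofR => h2.
by have := le_lt_trans (le_trans lhs h2) cn; rewrite ltxx.
Qed.

End DirectSum.

Theorem mainTheorem2 (R : realType) (K : numFieldType)
    (hK : real_or_complex R K)
    (F E : completeNormedModType K)
    (hF : script_L1_space F) (hE : contains_linf_uniformly E)
    (Q : {linear F -> E}) (Qbounded : bounded_op Q)
    (Qsurj : forall y : E, exists x : F, Q x = y) :
  exists (H : completeNormedModType K) (u : {linear lsubspace_of (lin_ker Q) -> H}),
    [/\ is_hilbert H, bounded_op u & ~ two_summing u].
Proof.
have [S] := real_or_complex_parts hK.
have [C1 [C2 [C10 C20 blocks]]] := kernel_blocks S hF hE Qbounded Qsurj.
have [|u [ub u2]] := direct_sum_operator (S := S)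
    (Z := lsubspace_of (lin_ker Q)) C10 C20.
  move=> X; have [k [w [z [w_lin w_le Qz z_le zX]]]] := blocks X.
  have kz i : z i \in lin_ker Q by rewrite inE Qz.
  exists k, (w \o @lsubspace_val _ _ _), (fun i => LSubspaceOf (kz i)).
  split=> // [a x y i|x|b].
  - exact: w_lin.
  - by apply: w_le; case: x => x /= /eqP.
  - by rewrite nm_lsubspace linear_sum; exact: z_le.
exists (hilbert S), u; split=> //; exact: hilbert_is_hilbert.
Qed.
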